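(* Let $\rho\in(0,1)$ and $\alpha\in(0,1)$. Let $X_1,X_2,\dots$ be jointly Gaussian with $X_i\sim N(\mu_i,1)$, $\mu_i\ge 0$, and $\operatorname{Corr}(X_i,X_j)=\rho$ for all $i\ne j$. For each $n\ge2$ let $\mathcal I_0=\{i\in\{1,\dots,n\}:\mu_i=0\}$, $n_0=|\mathcal I_0|$, and $$c_n(\alpha,\rho)=\sqrt{1-\rho}\,\Phi^{-1}\!\left(1-\tfrac1n\right)-\sqrt{\rho}\,\Phi^{-1}(\alpha).$$ If $\lim_{n\to\infty} n_0/n=p_0$ for some $p_0>0$, then $$\lim_{n\to\infty}\mathrm{FWER}^{I}(n,\alpha,\rho)=\lim_{n\to\infty}\mathbb{P}\left(\bigcup_{i\in\mathcal I_0}\{X_i>c_n(\alpha,\rho)\}\right)=\alpha.$$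
   Context: $\Phi$ is the standard normal distribution function. For each $n$ one tests $\mathrm{H}_{0i}:\mu_i=0$ versus $\mathrm{H}_{1i}:\mu_i>0$ for $i=1,\dots,n$; $\mathcal I_0$ (depending on $n$) is the index set of true nulls. The procedure rejects $\mathrm{H}_{0i}$ whenever $X_i>c_n(\alpha,\rho)$, and $\mathrm{FWER}^{I}(n,\alpha,\rho)$ is its family-wise error rate, i.e. the probability of at least one rejection of a true null hypothesis. *)

(* Defs.v *)
From HB Require Import structures.
From mathcomp Require Import all_boot all_order all_algebra.
From mathcomp Require Import all_classical all_reals all_analysis.

Set Implicit Arguments.
Unset Strict Implicit.
Unset Printing Implicit Defensive.

Import Order.TTheory GRing.Theory Num.Theory.
Import numFieldNormedType.Exports.

Local Open Scope classical_set_scope.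
Local Open Scope ring_scope.

(* The normal law with mean [m] and standard deviation [s]; [normal_prob m 0]
   is not the point mass at [m], so the degenerate case is treated apart. *)
Definition gaussian_law (R : realType) (m s : R) :
    set (measurableTypeR R) -> \bar R :=
  if s == 0 then dirac m else normal_prob m s.

(* Measures are total set functions, arbitrary outside the sigma-algebra, so
   laws are compared on measurable sets only. *)
Definition has_gaussian_law d (T : measurableType d) (R : realType)
    (P : probability T R) (Y : T -> R) (m s : R) : Prop :=
  forall A : set (measurableTypeR R), measurable A ->
    P (Y @^-1` A) = gaussian_law m s A.

Definition jointly_gaussian d (T : measurableType d) (R : realType)
    (P : probability T R) (X : nat -> T -> R) : Prop :=
  forall (n : nat) (a : 'I_n -> R), exists m s : R,
    0 <= s /\ has_gaussian_law P (fun w => \sum_(i < n) a i * X i w) m s.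

Definition correlation d (T : measurableType d) (R : realType)
    (P : probability T R) (X Y : T -> R) : R :=
  fine (covariance P X Y) /
    (Num.sqrt (fine ('V_P[X])) * Num.sqrt (fine ('V_P[Y]))).

Definition Phi (R : realType) (x : R) : R :=
  fine (normal_prob (0 : R) 1 `]-oo, x]).

(* [Phi] is injective with image `]0, 1[; outside of it the value is the
   default 0. *)
Definition Phi_inv (R : realType) : R -> R :=
  'pinv_(fun=> 0) [set: R] (@Phi R).

Definition critical_value (R : realType) (n : nat) (alpha rho : R) : R :=
  Num.sqrt (1 - rho) * Phi_inv (1 - n%:R^-1) - Num.sqrt rho * Phi_inv alpha.

(* Hypotheses are numbered from 0: [i : 'I_n] stands for the index i + 1. *)
Definition true_nulls (R : realType) (mu : nat -> R) (n : nat) : {set 'I_n} :=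
  [set i : 'I_n | mu i == 0]%SET.

Definition rejections (T : Type) (R : realType) (X : nat -> T -> R) (n : nat)
    (c : R) (w : T) : {set 'I_n} :=
  [set i : 'I_n | c < X i w]%SET.

(* A multiple testing procedure maps an outcome to the set of rejected
   hypotheses; an error is made when some true null is rejected. *)
Definition FWER d (T : measurableType d) (R : realType) (P : probability T R)
    (n : nat) (I0 : {set 'I_n}) (proc : T -> {set 'I_n}) : \bar R :=
  P [set w | (1 <= #|(I0 :&: proc w)%SET|)%N].

(* Main.v *)
(* Joint normality only provides the laws of linear combinations of the [X
   i]. Let [n0] be the number of true nulls, whose means vanish. Subtracting
   from each of their [X i] a common multiple [V] of their mean, one obtains
   [X i = V + sqrt (1 - rho) * Z i], where the [Z i] are uncorrelated and
   standard normal and the standard deviation of [V] tends to [sqrt rho]. The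
   maximum of the [Z i] is close to [q = Phi^-1 (1 - 1 / n)]: it exceeds [q +
   e] rarely by the union bound, and [q - e] with high probability by
   Chebyshev's inequality for the number of exceedances; [e = 1 / sqrt q]
   makes both errors vanish because [tail (x + e) <= exp (- x e) * tail x].
   Hence a true null is rejected essentially when [V > - sqrt rho * Phi^-1
   alpha], an event whose probability tends to [alpha].

   Chebyshev's inequality needs the pairwise independence of the exceedances.
   The identity [E cos (a Z1 + b Z2) = E cos (a Z1) * E cos (b Z2)] makes
   expectations of products of trigonometric polynomials in [Z1] and in [Z2]
   factor, and the indicator of a half-line is an iterated pointwise limit of
   uniformly bounded trigonometric polynomials. *)

From HB Require Import structures.
From mathcomp Require Import all_boot all_order all_algebra.
From mathcomp Require Import all_classical all_reals all_analysis.
From mathcomp Require Import measurable_realfun ring lra.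
Require Import Defs.

Set Implicit Arguments.
Unset Strict Implicit.
Unset Printing Implicit Defensive.

Import Order.TTheory GRing.Theory Num.Theory.
Import numFieldNormedType.Exports.

Local Open Scope classical_set_scope.
Local Open Scope ring_scope.

(** * Affine changes of variables for Lebesgue measure *)

Section linear_change_of_variables.
Context {R : realType}.
Implicit Types (m s : R).
Local Notation lambda := (@lebesgue_measure R).

Definition affine m s : measurableTypeR R -> measurableTypeR R :=
  fun x => m + s * x.

Lemma measurable_affine m s : measurable_fun setT (affine m s).
Proof. by apply: measurable_funD => //; exact: measurable_funM. Qed.

(** By uniqueness of Lebesgue measure it suffices that the pushforward scaled by [s] gives half-open
    intervals their length. *)
Lemma lebesgue_measure_affine m s (s0 : 0 < s) (A : set (measurableTypeR R)) :
  measurable A -> lambda A = (s%:E * lambda (affine m s @^-1` A))%E.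
Proof.
move=> mA; have sn : 0 <= s by exact: ltW.
have mf := measurable_affine m s.
pose nu := mscale (NngNum sn) (pushforward lambda (affine m s)).
rewrite (@lebesgue_measure_unique R (nu mf))// => _ [[a b]] _ <-.
rewrite /nu /mscale /=.
pose J : set R := `](a - m) / s, (b - m) / s]%classic.
transitivity (s%:E * lambda J)%E.
  rewrite !lebesgue_measure_itv/= !lte_fin ltr_pM2r ?invr_gt0// ltrD2r.
  case: ifP => _; last by rewrite mule0.
  by rewrite -!EFinB -EFinM -mulrBl mulrCA mulfV ?gt_eqF// mulr1 opprB addrA subrK.
congr (_ * lambda _)%E; apply/seteqP; split => x; rewrite /J /affine/= !in_itv/=.
  by rewrite ltr_pdivrMr// ler_pdivlMr// ltrBlDl lerBrDl mulrC.
by rewrite ltr_pdivrMr// ler_pdivlMr// ltrBlDl lerBrDl mulrC.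
Qed.

Lemma ge0_integral_affine m s (s0 : 0 < s) (A : set (measurableTypeR R))
    (f : R -> \bar R) :
  measurable A -> measurable_fun setT f -> (forall x, 0 <= f x)%E ->
  (\int[lambda]_(x in A) f x =
   \int[lambda]_(x in affine m s @^-1` A) (s%:E * f (m + s * x)%R))%E.
Proof.
move=> mA mf f0; have sn : 0 <= s by exact: ltW.
have maff := measurable_affine m s.
have mA' : measurable (affine m s @^-1` A).
  by rewrite -[X in measurable X]setTI; exact: maff.
pose nu := mscale (NngNum sn) (pushforward lambda (affine m s)).
rewrite (eq_measure_integral (nu maff)); last first.
  by move=> B mB _; exact: (lebesgue_measure_affine m s0 mB).
rewrite ge0_integral_mscale//; last exact: measurable_funTS.
rewrite ge0_integral_pushforward//; last exact: measurable_funTS.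
rewrite ge0_integralZl//=.
by apply: measurable_funTS; exact: measurableT_comp.
Qed.

End linear_change_of_variables.

(** * Gaussian laws as affine images of the standard normal law *)

Section standard_normal.
Context {R : realType}.
Implicit Types (m s : R).
Local Notation lambda := (@lebesgue_measure R).
Local Notation gamma := (normal_prob (0 : R) 1).

Lemma normal_pdf_affine m s (s0 : 0 < s) x :
  s * normal_pdf m s (m + s * x) = normal_pdf 0 1 x.
Proof.
have sn : s != 0 by rewrite gt_eqF.
rewrite !normal_pdfE ?oner_neq0// /normal_peak /normal_fun.
have -> : (m + s * x - m) ^+ 2 = s ^+ 2 * x ^+ 2 by ring.
rewrite subr0 expr1n mul1r -mulrnAr sqrtrM ?sqr_ge0// sqrtr_sqr gtr0_norm//.
rewrite invfM mulrA mulrA divff// mul1r; congr (_ * expR _).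
by field.
Qed.

(** This includes [s = 0], where the affine map is constant and its image law is the Dirac mass.
    Degenerate and nondegenerate laws can thus be treated alike. *)
Lemma gaussian_law_affine m s (A : set (measurableTypeR R)) :
  0 <= s -> measurable A -> gaussian_law m s A = gamma (affine m s @^-1` A).
Proof.
move=> s_ge0 mA; rewrite /gaussian_law; have [->|sn0] := eqVneq s 0.
  have [Am|Am] := pselect (A m).
    rewrite diracE mem_set// (_ : _ @^-1` _ = setT) ?probability_setT//.
    by apply/seteqP; split => // x _; rewrite /affine/= mul0r addr0.
  rewrite diracE memNset// (_ : _ @^-1` _ = set0) ?measure0//.
  by apply/seteqP; split => // x; rewrite /affine/= mul0r addr0.
have s0 : 0 < s by rewrite lt_neqAle eq_sym sn0.
rewrite /normal_prob (ge0_integral_affine m s0 mA)/=.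
- by apply: eq_integral => x _; rewrite -EFinM normal_pdf_affine.
- by apply/measurable_EFinP; exact: measurable_normal_pdf.
- by move=> x; rewrite lee_fin normal_pdf_ge0.
Qed.

(** Lebesgue measure is invariant under negation and the density is even. *)
Lemma normal_probN (A : set (measurableTypeR R)) :
  measurable A -> gamma ((fun x : measurableTypeR R => - x) @^-1` A) = gamma A.
Proof.
move=> mA; rewrite /normal_prob.
have mN : measurable_fun [set: measurableTypeR R]
    (fun x : measurableTypeR R => - x) by exact: oppr_measurable.
pose nu := @pushforward _ _ (measurableTypeR R) (measurableTypeR R) R lambda
  (fun x => - x).
rewrite [RHS](eq_measure_integral nu); last first.
  by move=> B mB _; exact/esym/lebesgue_measureN.
rewrite ge0_integral_pushforward//=.
- apply: eq_integral => x _; rewrite !normal_pdfE ?oner_neq0// /normal_fun.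
  by rewrite !subr0 sqrrN.
- by apply: measurable_funTS; apply/measurable_EFinP; exact: measurable_normal_pdf.
- by move=> x _; rewrite lee_fin normal_pdf_ge0.
Qed.

(** The normal density agrees almost everywhere with the Radon-Nikodym derivative of the law, since
    both have the same integral over every measurable set. *)
Lemma integral_normal_prob m s (f : R -> \bar R) U :
  measurable U -> measurable_fun U f ->
  (\int[normal_prob m s]_(x in U) `|f x| < +oo)%E ->
  (\int[normal_prob m s]_(x in U) f x =
   \int[lambda]_(x in U) (f x * (normal_pdf m s x)%:E))%E.
Proof.
move=> mU mf finf; have dom := normal_prob_dominates m s.
have mpdf : measurable_fun U (EFin \o normal_pdf m s).
  by apply/measurable_EFinP/measurable_funTS; exact: measurable_normal_pdf.
rewrite -(Radon_Nikodym_change_of_variables dom)//=; last first.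
  by apply/integrableP; split.
apply: ae_eq_integral => //.
- apply: emeasurable_funM => //; apply: (measurable_int lambda).
  apply: (integrableS _ _ (@subsetT _ _)) => //=.
  by apply: Radon_Nikodym_integrable; exact: dom.
- exact: emeasurable_funM.
- apply: ae_eqe_mul2l => /=.
  rewrite Radon_NikodymE.
  case: cid => /= h [h1 h2 h3].
  apply: integral_ae_eq => //=.
  + exact: integrableS h2.
  + by move=> E E01 mE; rewrite -h3.
Qed.

End standard_normal.

(** * Integrals of functions of a Gaussian variable *)

Section gaussian_law_integral.
Local Open Scope ereal_scope.
Context d (T : measurableType d) (R : realType) (P : probability T R).
Variables (Y : T -> R) (m s : R).
Hypotheses (mY : measurable_fun setT Y) (s_ge0 : (0 <= s)%R).
Hypothesis Y_law : has_gaussian_law P Y m s.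
Local Notation gamma := (normal_prob (0 : R) 1).

(** Both sides are integrals against pushforward measures, and these need only be compared on
    measurable sets, which is what [has_gaussian_law] provides. *)
Let ge0_gaussian_integral (f : R -> \bar R) :
  measurable_fun setT f -> (forall x, 0 <= f x) ->
  \int[P]_w f (Y w) = \int[gamma]_x f (m + s * x)%R.
Proof.
move=> mf f0; have maff := measurable_affine m s.
transitivity (\int[pushforward P (Y : T -> measurableTypeR R)]_x f x).
  by rewrite ge0_integral_pushforward.
transitivity (\int[pushforward gamma (affine m s)]_x f x); last first.
  by rewrite ge0_integral_pushforward.
apply: eq_measure_integral => A mA _.
by apply: etrans (gaussian_law_affine m s_ge0 mA); exact: Y_law.
Qed.

(** The positive and negative parts are transported separately. The identity lives in the extended
    reals, so it can also serve to establish that an integral is finite. *)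
Lemma gaussian_integral (f : R -> \bar R) : measurable_fun setT f ->
  \int[P]_w f (Y w) = \int[gamma]_x f (m + s * x)%R.
Proof.
move=> mf; rewrite integralE [in RHS]integralE.
have /ge0_gaussian_integral fp : measurable_fun setT f^\+.
  exact: measurable_funepos.
have /ge0_gaussian_integral fn : measurable_fun setT f^\-.
  exact: measurable_funeneg.
congr (_ - _).
  transitivity (\int[P]_w f^\+ (Y w)); first by rewrite [in LHS]funepos_comp.
  rewrite fp => [|x]; last exact: funepos_ge0.
  by rewrite [in RHS]funepos_comp.
transitivity (\int[P]_w f^\- (Y w)); first by rewrite [in LHS]funeneg_comp.
rewrite fn => [|x]; last exact: funeneg_ge0.
by rewrite [in RHS]funeneg_comp.
Qed.

Lemma gaussian_integrable (f : R -> \bar R) : measurable_fun setT f ->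
  P.-integrable setT (fun w => f (Y w)) <->
  gamma.-integrable setT (fun x => f (m + s * x)%R).
Proof.
move=> mf.
have mfY : measurable_fun setT (fun w => f (Y w)) by exact: measurableT_comp.
have mfa : measurable_fun setT (fun x : measurableTypeR R => f (m + s * x)%R).
  by apply: (measurableT_comp mf); exact: measurable_affine.
have /gaussian_integral E : measurable_fun setT (fun x : R => `|f x|).
  exact: measurableT_comp.
split => /integrableP[_ fi]; apply/integrableP; split => //.
  by rewrite -[X in X < _]E.
by rewrite [X in X < _]E.
Qed.

Lemma gaussian_Rintegral (f : R -> R) : measurable_fun setT f ->
  (\int[P]_w f (Y w) = \int[gamma]_x f (m + s * x))%R.
Proof.
move=> mf; congr fine; apply: (gaussian_integral (f := EFin \o f)).
exact/measurable_EFinP.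
Qed.

End gaussian_law_integral.

Lemma bounded_integrable d (T : measurableType d) (R : realType)
    (P : probability T R) (f : T -> R) (M : R) :
  measurable_fun setT f -> (forall x, `|f x| <= M) ->
  P.-integrable setT (EFin \o f).
Proof.
move=> mf fM; apply: measurable_bounded_integrable => //.
  by rewrite -[X in (X < _)%E]/(P setT) probability_setT ltry.
exists M; split; first exact: num_real.
by move=> N MN x _ /=; exact: le_trans (fM x) (ltW MN).
Qed.

(** * Convolution of centered normal laws *)

Section gaussian_convolution.
Context {R : realType}.
Local Notation gamma := (normal_prob (0 : R) 1).
Local Notation lambda := (@lebesgue_measure R).

Lemma normal_prob_law (m s : R) :
  s != 0 -> has_gaussian_law (normal_prob m s) (fun x => x) m s.
Proof. by move=> s0 A mA; rewrite /gaussian_law (negbTE s0). Qed.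

Lemma integral_normal_probN (f : R -> \bar R) : measurable_fun setT f ->
  (\int[gamma]_x f (- x)%R = \int[gamma]_x f x)%E.
Proof.
move=> mf; have mN : measurable_fun [set: measurableTypeR R]
    (fun x : measurableTypeR R => - x) by exact: oppr_measurable.
rewrite (@gaussian_integral _ _ _ gamma (fun x => - x) 0 1)//.
  by apply: eq_integral => x _; rewrite add0r mul1r.
move=> A mA; rewrite /gaussian_law oner_eq0.
exact: normal_probN.
Qed.

Lemma normal_peakE (s : R) : 0 < s -> normal_peak s = s^-1 * normal_peak 1.
Proof.
move=> s0; rewrite /normal_peak expr1n mul1r -mulrnAr sqrtrM ?sqr_ge0//.
by rewrite sqrtr_sqr gtr0_norm// invfM.
Qed.

(* Completing the square in [x]. *)
Lemma normal_pdf_convolution (a b x u : R) (s := Num.sqrt (a ^+ 2 + b ^+ 2)) :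
  0 < b ->
  normal_pdf (a * x) b u * normal_pdf 0 1 x =
  normal_pdf 0 s u * normal_pdf (a * u / s ^+ 2) (b / s) x.
Proof.
move=> b0; have s2 : s ^+ 2 = a ^+ 2 + b ^+ 2.
  by rewrite sqr_sqrtr// addr_ge0 ?sqr_ge0.
have s2_gt0 : 0 < a ^+ 2 + b ^+ 2 by rewrite ltr_wpDl ?sqr_ge0// exprn_gt0.
have s0 : 0 < s by rewrite sqrtr_gt0.
have bs0 : 0 < b / s by rewrite divr_gt0.
rewrite !normal_pdfE ?gt_eqF// (normal_peakE b0) (normal_peakE s0) (normal_peakE bs0).
rewrite /normal_fun mulrACA [RHS]mulrACA -!expRD; congr (_ * expR _).
  by field; rewrite !gt_eqF.
rewrite expr_div_n s2 subr0 expr1n; field.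
by rewrite !gt_eqF.
Qed.

(** Substitute [u = a * x + b * y] in the inner integral, exchange the integrals and integrate [x]
    out by means of [normal_pdf_convolution]. The kernel [K] is nonnegative so that Tonelli's
    theorem applies. *)
Lemma integral_normal_convolution (a b M : R) (K : R -> R) : 0 < b ->
  measurable_fun setT K -> (forall x, 0 <= K x <= M) ->
  (\int[gamma]_x \int[gamma]_y (K (a * x + b * y))%:E =
   \int[gamma]_x (K (Num.sqrt (a ^+ 2 + b ^+ 2) * x))%:E)%E.
Proof.
move=> b0 mK K_bnd; set s := Num.sqrt _.
have b_neq0 : b != 0 by rewrite gt_eqF.
have s_neq0 : s != 0.
  by rewrite gt_eqF// sqrtr_gt0 ltr_wpDl ?sqr_ge0// exprn_gt0.
have mEK : measurable_fun setT (EFin \o K) by exact/measurable_EFinP.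
have Kfin (m c : R) : (\int[normal_prob m c]_x `|(K x)%:E| < +oo)%E.
  have /integrableP[] // : (normal_prob m c).-integrable setT (EFin \o K).
  apply: (@bounded_integrable _ _ _ _ _ M) => // x.
  by rewrite ger0_norm; have /andP[] := K_bnd x.
(* Used twice: for the inner integral with [m = a * x], and for the right-hand side with [m = 0]. *)
have step (m c : R) : 0 < c ->
    (\int[gamma]_y (K (m + c * y))%:E =
     \int[lambda]_u ((K u)%:E * (normal_pdf m c u)%:E))%E.
  move=> c0; have cn : c != 0 by rewrite gt_eqF.
  rewrite -(integral_normal_prob measurableT mEK (Kfin m c)).
  apply/esym.
  exact (@gaussian_integral _ (measurableTypeR R) R (normal_prob m c) id m c
    (@measurable_id _ _ _) (ltW c0) (normal_prob_law m cn) _ mEK).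
have -> : (\int[gamma]_x \int[gamma]_y (K (a * x + b * y))%:E =
    \int[gamma]_x \int[lambda]_u ((K u)%:E * (normal_pdf (a * x) b u)%:E))%E.
  by apply: eq_integral => x _; exact: step.
pose F (z : measurableTypeR R * measurableTypeR R) :=
  ((K z.2)%:E * (normal_pdf (a * z.1) b z.2)%:E)%E.
have mF : measurable_fun setT F.
  apply: emeasurable_funM; apply/measurable_EFinP.
    exact: (measurableT_comp mK (@measurable_snd _ _ _ _)).
  rewrite [X in measurable_fun _ X](_ : _ = fun z => normal_peak b *
      expR (- (z.2 - a * z.1) ^+ 2 / (b ^+ 2 *+ 2))); last first.
    by apply/funext => z; rewrite normal_pdfE.
  apply: measurable_funM; first exact: measurable_cst.
  apply: measurableT_comp => //; apply: measurable_funM; last exact: measurable_cst.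
  apply: measurableT_comp => //; apply: measurable_funX.
  apply: measurable_funB; first exact: measurable_snd.
  by apply: measurable_funM; [exact: measurable_cst|exact: measurable_fst].
have K0 x : 0 <= K x by have /andP[] := K_bnd x.
have F0 z : (0 <= F z)%E by rewrite /F -EFinM lee_fin mulr_ge0 ?normal_pdf_ge0.
have := @fubini_tonelli _ _ _ _ _ gamma lambda F mF F0.
rewrite /F/= => ->.
transitivity (\int[lambda]_u ((K u)%:E * (normal_pdf 0 s u)%:E))%E; last first.
  rewrite -step ?sqrtr_gt0 ?ltr_wpDl ?sqr_ge0 ?exprn_gt0//.
  by apply: eq_integral => x _; rewrite add0r.
apply: eq_integral => u _.
have mp : measurable_fun [set: measurableTypeR R]
    (fun x : measurableTypeR R => normal_pdf (a * x) b u).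
  rewrite [X in measurable_fun _ X](_ : _ = fun x => normal_peak b *
      expR (- (u - a * x) ^+ 2 / (b ^+ 2 *+ 2))); last first.
    by apply/funext => x; rewrite normal_pdfE.
  apply: measurable_funM; first by [].
  apply: measurableT_comp => //; apply: measurable_funM; last by [].
  apply: measurableT_comp => //; apply: measurable_funX.
  apply: measurable_funB; first by [].
  by apply: measurable_funM.
have mEp : measurable_fun [set: measurableTypeR R]
    (fun x : measurableTypeR R => (normal_pdf (a * x) b u)%:E).
  exact/measurable_EFinP.
rewrite ge0_integralZl//; [|
  by move=> x _; rewrite lee_fin normal_pdf_ge0|by rewrite lee_fin].
congr (_ * _)%E.
have /integrableP[_ pfin] : gamma.-integrable setT
    (EFin \o (fun x => normal_pdf (a * x) b u)).
  apply: (@bounded_integrable _ _ _ _ _ (normal_peak b)) => // x.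
  by rewrite ger0_norm ?normal_pdf_ge0// normal_pdf_ub.
rewrite (integral_normal_prob measurableT mEp pfin).
(* After completing the square, the factor that depends on [x] is a normal density and integrates to
   1. *)
transitivity (\int[lambda]_x ((normal_pdf 0 s u)%:E *
    (normal_pdf (a * u / s ^+ 2) (b / s) x)%:E))%E.
  by apply: eq_integral => x _; rewrite -!EFinM normal_pdf_convolution.
rewrite ge0_integralZl//.
- by rewrite integral_normal_pdf mule1.
- by apply/measurable_EFinP; exact: measurable_normal_pdf.
- by move=> x _; rewrite lee_fin normal_pdf_ge0.
- by rewrite lee_fin normal_pdf_ge0.
Qed.

End gaussian_convolution.

(** * Expectations of cosines *)

Section trigonometric_integrals.
Context d (T : measurableType d) (R : realType) (P : probability T R).
Implicit Types (Y : T -> R).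

Lemma EFin_Rintegral (f : T -> R) : P.-integrable setT (EFin \o f) ->
  (\int[P]_w (f w)%:E)%E = (\int[P]_w f w)%:E.
Proof. by move=> fi; rewrite /Rintegral fineK//; exact: integrable_fin_num. Qed.

Lemma Rintegral_probability_cst (c : R) : \int[P]_w c = c.
Proof. by rewrite Rintegral_cst// -[X in fine X]/(P setT) probability_setT mulr1. Qed.

Lemma measurable_cosD Y c : measurable_fun setT Y ->
  measurable_fun setT (fun w => cos (Y w + c)).
Proof.
move=> mY; apply: (@measurableT_comp _ _ _ _ _ _ (@cos R)).
  by apply: continuous_measurable_fun; exact: continuous_cos.
exact: measurable_funD.
Qed.

Lemma measurable_sin_comp Y : measurable_fun setT Y ->
  measurable_fun setT (fun w => sin (Y w)).
Proof.
move=> mY; apply: (@measurableT_comp _ _ _ _ _ _ (@sin R)) => //.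
by apply: continuous_measurable_fun; exact: continuous_sin.
Qed.

Lemma integrable_cosD Y c : measurable_fun setT Y ->
  P.-integrable setT (EFin \o (fun w => cos (Y w + c))).
Proof.
move=> mY; apply: (@bounded_integrable _ _ _ _ _ 1); first exact: measurable_cosD.
by move=> w; exact: cos_max.
Qed.

Lemma integrable_cos Y : measurable_fun setT Y ->
  P.-integrable setT (EFin \o (fun w => cos (Y w))).
Proof.
move=> mY; rewrite (_ : (fun w => _) = fun w => cos (Y w + 0)).
  exact: integrable_cosD.
by apply/funext => w; rewrite addr0.
Qed.

Lemma Rintegral_cosD Y c : measurable_fun setT Y ->
  \int[P]_w sin (Y w) = 0 ->
  \int[P]_w cos (Y w + c) = cos c * \int[P]_w cos (Y w).
Proof.
move=> mY sin0.
have si : P.-integrable setT (EFin \o (fun w => sin (Y w))).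
  apply: (@bounded_integrable _ _ _ _ _ 1); first exact: measurable_sin_comp.
  by move=> w; exact: sin_max.
under eq_Rintegral do rewrite cosD mulrC [sin _ * _]mulrC.
rewrite RintegralB//; last 2 first.
- apply: (@bounded_integrable _ _ _ _ _ 1).
    apply: measurable_funM => //.
    by have /measurable_EFinP := measurable_int _ (integrable_cos mY).
  by move=> w; rewrite normrM mulr_ile1// cos_max.
- apply: (@bounded_integrable _ _ _ _ _ 1).
    by apply: measurable_funM => //; exact: measurable_sin_comp.
  by move=> w; rewrite normrM mulr_ile1// sin_max.
rewrite RintegralZl//; last exact: integrable_cos.
by rewrite RintegralZl// sin0 mulr0 subr0.
Qed.

(** The shift by 1 prepares for [integral_normal_convolution], which applies to nonnegative
    functions; the factor [c] will be 1 or a value of [gauss_cos]. *)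
Lemma Rintegral_1Dcos Y c : measurable_fun setT Y ->
  (\int[P]_w (1 + c * cos (Y w))%:E)%E = (1 + c * \int[P]_w cos (Y w))%:E.
Proof.
move=> mY; have ci := integrable_cos mY.
have c1 : P.-integrable setT (EFin \o (fun=> 1%R : R)).
  by apply: (@bounded_integrable _ _ _ _ _ 1) => // w; rewrite normr1.
have c2 : P.-integrable setT (EFin \o (fun w => c * cos (Y w))).
  apply: (@bounded_integrable _ _ _ _ _ `|c|).
    by apply: measurable_funM => //; have /measurable_EFinP := measurable_int _ ci.
  by move=> w; rewrite normrM ler_piMr// cos_max.
rewrite (@EFin_Rintegral (fun w => 1 + c * cos (Y w))); last first.
  apply: (@bounded_integrable _ _ _ _ _ (1 + `|c|)).
    apply: measurable_funD => //.
    by have /measurable_EFinP := measurable_int _ c2.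
  move=> w; rewrite (le_trans (ler_normD _ _))// normr1 lerD2l normrM ler_piMr//.
  exact: cos_max.
by rewrite RintegralD// RintegralZl// Rintegral_probability_cst.
Qed.

End trigonometric_integrals.

(** * The characteristic function of the standard normal law *)

Section gaussian_cosine.
Context {R : realType}.
Local Notation gamma := (normal_prob (0 : R) 1).

(** This is the characteristic function of the standard normal law, whose imaginary part vanishes by
    [gauss_sin]. *)
Definition gauss_cos (t : R) : R := \int[gamma]_x cos (t * x).

Let mlin (t : R) : measurable_fun [set: measurableTypeR R]
  (fun x : measurableTypeR R => t * x).
Proof. by apply: measurable_funM. Qed.

(** The sine is odd and the law symmetric, so the integral equals its opposite. *)
Lemma gauss_sin (t : R) : \int[gamma]_x sin (t * x) = 0.
Proof.
have ms := measurable_sin_comp (mlin t).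
have si : gamma.-integrable setT (EFin \o (fun x => sin (t * x))).
  exact (@bounded_integrable _ _ _ gamma _ 1 ms (fun w => sin_max _)).
have E : \int[gamma]_x sin (t * x) = - \int[gamma]_x sin (t * x).
  rewrite -mulN1r -RintegralZl//; congr fine.
  rewrite -[LHS]integral_normal_probN; last exact/measurable_EFinP.
  by apply: eq_integral => x _; rewrite mulrN sinN mulN1r.
by move: (\int[gamma]_x sin (t * x)) E => z E; lra.
Qed.

Lemma gauss_cosD (t c : R) : \int[gamma]_x cos (t * x + c) = cos c * gauss_cos t.
Proof. exact (Rintegral_cosD c (mlin t) (gauss_sin t)). Qed.

Lemma gauss_cos0 : gauss_cos 0 = 1.
Proof.
rewrite /gauss_cos -[RHS](Rintegral_probability_cst gamma).
by apply: eq_Rintegral => x _; rewrite mul0r cos0.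
Qed.

Lemma gauss_cosN t : gauss_cos (- t) = gauss_cos t.
Proof. by apply: eq_Rintegral => x _; rewrite mulNr cosN. Qed.

(** Integrating [cos (b * y + a * x)] in [y] gives [cos (a * x) * gauss_cos b], so the left side is
    a double integral of [cos (a * x + b * y)]; the convolution identity turns it into the right
    side. *)
Lemma gauss_cosM (a b : R) :
  gauss_cos a * gauss_cos b = gauss_cos (Num.sqrt (a ^+ 2 + b ^+ 2)).
Proof.
(* The convolution identity asks for [0 < b]. Evenness covers [b < 0], and for [b = 0] the square
   root is the absolute value of [a]. *)
wlog b0 : b / 0 < b.
  move=> H; have [b_lt0|b_gt0|->] := ltgtP b 0; [|exact: H|].
    by rewrite -(gauss_cosN b) -(sqrrN b) H// oppr_gt0.
  rewrite gauss_cos0 mulr1 expr0n/= addr0 sqrtr_sqr.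
  by case: (ger0P a) => _; rewrite ?gauss_cosN.
(* Adding 1 to both sides leads to the nonnegative kernel [1 + cos u], bounded by 2. *)
apply/eqP; rewrite -(inj_eq (addrI 1)); apply/eqP/EFin_inj.
have mc : measurable_fun setT (fun u : R => 1 + cos u).
  apply: measurable_funD => //; apply: continuous_measurable_fun.
  exact: continuous_cos.
have K_bnd (u : R) : 0 <= 1 + cos u <= 2.
  by have := cos_geN1 u; have := cos_le1 u => ? ?; apply/andP; split; lra.
have E t c : (\int[gamma]_x (1 + c * cos (t * x))%:E)%E = (1 + c * gauss_cos t)%:E.
  exact (Rintegral_1Dcos gamma c (mlin t)).
transitivity (\int[gamma]_x (1 + cos (Num.sqrt (a ^+ 2 + b ^+ 2) * x))%:E)%E; last first.
  rewrite -[in RHS](mul1r (gauss_cos _)) -E.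
  by apply: eq_integral => x _; rewrite mul1r.
rewrite -(integral_normal_convolution a b0 mc K_bnd) mulrC -E.
apply: eq_integral => x _; rewrite (mulrC (gauss_cos b)).
have mb := measurable_cosD (a * x) (mlin b).
have ib := integrable_cosD gamma (a * x) (mlin b).
transitivity ((1 + 1 * \int[gamma]_y cos (b * y + a * x))%:E).
  by rewrite gauss_cosD mul1r.
have ma : measurable_fun [set: measurableTypeR R]
  (fun y : measurableTypeR R => b * y + a * x) by exact: measurable_funD.
rewrite -(Rintegral_1Dcos gamma 1 ma).
by apply: eq_integral => y _; rewrite mul1r [b * y + _]addrC.
Qed.

End gaussian_cosine.

(** * Powers approximating a step at 1/2 *)

Section steep_powers.
Context {R : realType}.
Implicit Types (x u r s : R).

Lemma bernoulli_ge u n : 0 <= u <= 1 -> 1 - u *+ n <= (1 - u) ^+ n.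
Proof.
move=> /andP[u0 u1]; elim: n => [|n IH]; first by rewrite mulr0n subr0 expr0.
rewrite exprS; apply: (@le_trans _ _ ((1 - u) * (1 - u *+ n))).
  rewrite mulrBl mul1r mulrBr mulr1 mulrS.
  have : 0 <= u * u *+ n by rewrite mulrn_wge0// mulr_ge0.
  by rewrite -mulrnAr; lra.
by rewrite ler_wpM2l// subr_ge0.
Qed.

(** Each of the [n] terms of the geometric sum [(1 - s ^+ n) / (1 - s)] is at least [s ^+ n]; the
    proof is an induction on [n]. *)
Lemma mulrn_expr_le s n : 0 <= s < 1 -> (s ^+ n *+ n) * (1 - s) <= 1 - s ^+ n.
Proof.
move=> /andP[s0 s1]; elim: n => [|n IH]; first by rewrite mulr0n mul0r expr0 subrr.
have -> : (s ^+ n.+1 *+ n.+1) * (1 - s) =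
    s * ((s ^+ n *+ n) * (1 - s)) + s ^+ n.+1 * (1 - s).
  by rewrite mulrS mulrDl addrC exprS mulrA mulrnAr.
have H := ler_wpM2l s0 IH.
have p1 : s ^+ n.+1 <= 1 by rewrite exprn_ile1// ltW.
have : 0 <= (1 - s ^+ n.+1) * (1 - s) by rewrite mulr_ge0 ?subr_ge0// ltW.
move: H p1; rewrite exprS; nra.
Qed.

(** With [s] the square root of [r], one factor [s ^+ n] absorbs the multiple [n], by the previous
    bound, and the other one tends to 0. *)
Lemma cvg_mulrn_expr r : 0 <= r < 1 -> r ^+ n *+ n @[n --> \oo] --> (0 : R).
Proof.
move=> /andP[r0 r1]; pose s := Num.sqrt r.
have s0 : 0 <= s by exact: sqrtr_ge0.
have s1 : s < 1 by rewrite -[ltRHS]sqrtr1 ltr_sqrt.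
have ds : 0 < 1 - s by rewrite subr_gt0.
apply: (squeeze_cvgr (f := fun=> 0) (h := geometric (1 - s)^-1 s)).
- apply: nearW => n; rewrite mulrn_wge0 ?exprn_ge0//= /geometric/=.
  rewrite -(sqr_sqrtr r0) -/s -exprM mulnC exprM expr2 -mulrnAr mulrC.
  rewrite ler_wpM2r ?exprn_ge0// -[leRHS]mul1r ler_pdivlMr//.
  apply: le_trans (mulrn_expr_le _ _) _; first by rewrite s0.
  by rewrite gerBl exprn_ge0.
- exact: cvg_cst.
- by apply: cvg_geometric; rewrite ger0_norm.
Qed.

(** For [x < 1/2], Bernoulli's inequality bounds the power below by [1 - n (2 x)^n], which tends to
    1. For [1/2 <= x], the bound [1 - x^n <= exp (- 2^-n)] makes the power at most
    [exp (- n) <= 1 / (n + 1)]. *)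
Lemma cvg_steep_power x : 0 <= x <= 1 ->
  (1 - x ^+ n) ^+ (n * 2 ^ n) @[n --> \oo] --> ((x < 2^-1)%R%:R : R).
Proof.
move=> /andP[x0 x1]; have xn n : 0 <= x ^+ n <= 1.
  by rewrite exprn_ge0//= exprn_ile1.
have xn' n : 0 <= 1 - x ^+ n by rewrite subr_ge0; have /andP[] := xn n.
have [x_lt|x_ge] := ltP x 2^-1.
  have r01 : 0 <= 2 * x < 1 by apply/andP; split; lra.
  apply: (squeeze_cvgr (f := fun n => 1 - (2 * x) ^+ n *+ n) (h := fun=> 1)).
  - apply: nearW => n; apply/andP; split; last first.
      by rewrite exprn_ile1// gerBl; have /andP[] := xn n.
    apply: le_trans (bernoulli_ge _ (xn n)).
    by rewrite exprMn mulnC mulrnA -[x ^+ n *+ _]mulr_natl natrX.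
  - rewrite -[X in _ --> X]subr0; apply: cvgB; first exact: cvg_cst.
    exact: cvg_mulrn_expr.
  - exact: cvg_cst.
apply: (squeeze_cvgr (f := fun=> 0) (h := harmonic)).
- apply: nearW => n; rewrite exprn_ge0//= /harmonic.
  have h1 : 1 - x ^+ n <= expR (- 2^-1 ^+ n).
    apply: le_trans (expR_ge1Dx _); rewrite lerD2l lerN2.
    by apply: lerXn2r; rewrite ?nnegrE ?invr_ge0.
  apply: le_trans (lerXn2r _ _ _ h1) _; rewrite ?nnegrE ?expR_ge0//.
  rewrite -expRM_natl natrM natrX mulrN -mulrA -exprMn divff ?expr1n ?mulr1 ?pnatr_eq0//.
  by rewrite expRN lef_pV2 ?posrE ?expR_gt0 ?ltr0n// -natr1 addrC expR_ge1Dx.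
- exact: cvg_cst.
- exact: cvg_harmonic.
Qed.

End steep_powers.

(** * Trigonometric polynomials and indicators of half-lines *)

Section trigonometric_polynomials.
Context {R : realType}.
Implicit Types (f g : R -> R).

(** The phase [c] provides constants and sines, and keeps products of generators within sums of
    generators. *)
Inductive trig_poly : (R -> R) -> Prop :=
| trig_poly_cos k a c : trig_poly (fun y => k * cos (a * y + c))
| trig_polyD f g : trig_poly f -> trig_poly g -> trig_poly (fun y => f y + g y).

Lemma trig_poly_bounded f : trig_poly f ->
  measurable_fun setT f /\ exists M, forall y, `|f y| <= M.
Proof.
elim=> [k a c|{}f g _ [mf [M fM]] _ [mg [N gN]]]; split.
- apply: measurable_funM => //; apply: measurable_cosD.
  exact: measurable_funM.
- by exists `|k| => y; rewrite normrM ler_piMr// cos_max.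
- exact: measurable_funD.
- by exists (M + N) => y; rewrite (le_trans (ler_normD _ _))// lerD.
Qed.

Lemma trig_poly_cst k : trig_poly (fun=> k).
Proof.
rewrite (_ : (fun=> k) = fun y => k * cos (0 * y + 0)); first exact: trig_poly_cos.
by apply/funext => y; rewrite mul0r addr0 cos0 mulr1.
Qed.

(** The product-to-sum formula settles two cosines; bilinearity does the rest. *)
Lemma trig_polyM f g : trig_poly f -> trig_poly g -> trig_poly (fun y => f y * g y).
Proof.
move=> + tg; elim=> [k a c|{tg}f1 f2 _ IH1 _ IH2]; last first.
  rewrite (_ : (fun y => _) = fun y => f1 y * g y + f2 y * g y).
    exact: trig_polyD.
  by apply/funext => y; rewrite mulrDl.
elim: tg => [k' a' c'|g1 g2 _ IH1 _ IH2]; last first.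
  rewrite (_ : (fun y => _) = fun y => k * cos (a * y + c) * g1 y
      + k * cos (a * y + c) * g2 y); first exact: trig_polyD.
  by apply/funext => y; rewrite mulrDr.
rewrite (_ : (fun y => _) = fun y =>
    (k * k' / 2) * cos ((a + a') * y + (c + c')) +
    (k * k' / 2) * cos ((a - a') * y + (c - c'))).
  by apply: trig_polyD; exact: trig_poly_cos.
apply/funext => y.
have -> : (a + a') * y + (c + c') = (a * y + c) + (a' * y + c') by ring.
have -> : (a - a') * y + (c - c') = (a * y + c) - (a' * y + c') by ring.
move: (a * y + c) (a' * y + c') => u v.
by rewrite cosB cosD; field.
Qed.

Lemma trig_polyX f n : trig_poly f -> trig_poly (fun y => f y ^+ n).
Proof.
move=> tf; elim: n => [|n IH]; first exact: trig_poly_cst.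
rewrite (_ : (fun y => _) = fun y => f y * f y ^+ n); first exact: trig_polyM.
by apply/funext => y; rewrite exprS.
Qed.

Lemma trig_poly_sin k a c : trig_poly (fun y => k * sin (a * y + c)).
Proof.
rewrite (_ : (fun y => _) = fun y => k * cos (a * y + (c - pi / 2))).
  exact: trig_poly_cos.
by apply/funext => y; rewrite addrA cosBpihalf.
Qed.

(* The values [1 - x ^+ n] with [x = (1 - sin (a * (y - t))) / 2] are raised to
   the power [n * 2 ^ n] so that they tend to 1 for [x < 1/2] and to 0 for
   [1/2 <= x]. *)
Definition steep_wave (a t : R) (n : nat) (y : R) : R :=
  (1 - ((1 - sin (a * (y - t))) / 2) ^+ n) ^+ (n * 2 ^ n).

Lemma trig_poly_steep_wave a t n : trig_poly (steep_wave a t n).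
Proof.
apply: trig_polyX.
have tx : trig_poly (fun y => 2^-1 + (- 2^-1) * sin (a * y + (- (a * t)))).
  by apply: trig_polyD; [exact: trig_poly_cst|exact: trig_poly_sin].
rewrite (_ : (fun y => _) = fun y =>
    1 + (-1) * (2^-1 + (- 2^-1) * sin (a * y + (- (a * t)))) ^+ n).
  apply: trig_polyD; first exact: trig_poly_cst.
  by apply: trig_polyM; [exact: trig_poly_cst|exact: trig_polyX].
apply/funext => y; rewrite mulN1r; congr (_ - _ ^+ n).
by rewrite mulrBr; field.
Qed.

Let wave01 (a t y : R) : 0 <= (1 - sin (a * (y - t))) / 2 <= 1.
Proof.
have ? := @sin_geN1 R (a * (y - t)); have ? := @sin_le1 R (a * (y - t)).
by apply/andP; split; lra.
Qed.

Lemma steep_wave_bounded (a t : R) n (y : R) : `|steep_wave a t n y| <= 1.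
Proof.
have /andP[x0 x1] := wave01 a t y.
have xn : 0 <= ((1 - sin (a * (y - t))) / 2) ^+ n <= 1.
  by rewrite exprn_ge0//= exprn_ile1.
rewrite normrX exprn_ile1// ger0_norm; case/andP: xn => ? ?; lra.
Qed.

Lemma cvg_steep_wave (a t y : R) :
  steep_wave a t n y @[n --> \oo] --> ((0 < sin (a * (y - t)))%R%:R : R).
Proof.
have := cvg_steep_power (wave01 a t y).
suff -> : ((1 - sin (a * (y - t))) / 2 < 2^-1) = (0 < sin (a * (y - t))) by [].
by apply/idP/idP; lra.
Qed.

(** For fixed [y] the argument of the sine eventually has absolute value below [pi], and then the
    sine has the sign of [y - t]: the sequence is eventually constant. *)
Lemma cvg_sin_sign (t y : R) :
  ((0 < sin (n.+1%:R^-1 * (y - t)))%R%:R : R) @[n --> \oo] --> ((t < y)%R%:R : R).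
Proof.
have sgn a : 0 < a -> a * `|y - t| < pi -> (0 < sin (a * (y - t))) = (t < y).
  move=> a0; case: (ltrgt0P (y - t)) => yt abs.
  - rewrite -[t < y]subr_gt0 yt; apply: sin_gt0_pi.
    by rewrite abs andbT mulr_gt0.
  - rewrite -[t < y]subr_gt0 [in RHS]ltNge ltW//=; apply/negbTE; rewrite -leNgt ltW//.
    rewrite -[a * _]opprK sinN oppr_lt0 -mulrN; apply: sin_gt0_pi.
    by rewrite abs andbT mulr_gt0// oppr_gt0.
  - by rewrite yt mulr0 sin0 ltxx -[t < y]subr_gt0 yt ltxx.
apply: cvg_near_cst.
have : n.+1%:R^-1 * `|y - t| @[n --> \oo] --> (0 : R).
  rewrite -[X in _ --> X](mul0r `|y - t|).
  by apply: cvgM; [exact: cvg_harmonic|exact: cvg_cst].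
move/cvgr_lt => /(_ pi (pi_gt0 R)); apply: filterS => n h.
by rewrite sgn// invr_gt0.
Qed.

End trigonometric_polynomials.

Lemma cvg_Rintegral_bounded d (T : measurableType d) (R : realType)
    (P : probability T R) (h_ : nat -> T -> R) (h : T -> R) :
  (forall n, measurable_fun setT (h_ n)) -> (forall n w, `|h_ n w| <= 1) ->
  (forall w, h_ n w @[n --> \oo] --> h w) ->
  \int[P]_w h_ n w @[n --> \oo] --> \int[P]_w h w.
Proof.
move=> mh h1 hh.
have mlim : measurable_fun setT h by apply: (measurable_fun_cvg mh) => w _; exact: hh.
have lim1 w : `|h w| <= 1.
  by apply: (cvgr_to_le (cvg_norm (hh w))); exact: nearW.
have one_int : P.-integrable setT (EFin \o (fun=> 1 : R)).
  by apply: (@bounded_integrable _ _ _ _ _ 1) => // w; rewrite normr1.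
have hi : P.-integrable setT (EFin \o h) by apply: (@bounded_integrable _ _ _ _ _ 1).
apply: fine_cvg; rewrite -EFin_Rintegral//.
apply: (@dominated_cvg _ _ _ P setT measurableT (fun n => EFin \o h_ n)
  (EFin \o h) (EFin \o (fun=> 1 : R))) => //.
- by move=> n; exact/measurable_EFinP.
- by move=> w _; apply: cvg_EFin; [exact: nearW|exact: hh].
- by move=> n w _ /=; rewrite lee_fin.
Qed.

(** * Independence of the exceedances of two uncorrelated Gaussian variables *)

Section uncorrelated_gaussian_pair.
Context d (T : measurableType d) (R : realType) (P : probability T R).
Variables (Z1 Z2 : T -> R).
Hypotheses (mZ1 : measurable_fun setT Z1) (mZ2 : measurable_fun setT Z2).
Hypothesis pair_law : forall a b : R,
  has_gaussian_law P (fun w => a * Z1 w + b * Z2 w) 0 (Num.sqrt (a ^+ 2 + b ^+ 2)).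

(** The linear combination has standard deviation [Num.sqrt (a ^+ 2 + b ^+ 2)], exactly the argument
    that [gauss_cosM] factors. *)
Let Rintegral_cos_pair (a b c : R) :
  \int[P]_w cos (a * Z1 w + b * Z2 w + c) =
  cos c * (gauss_cos a * gauss_cos b).
Proof.
have mY : measurable_fun setT (fun w => a * Z1 w + b * Z2 w).
  by apply: measurable_funD; exact: measurable_funM.
have mf : measurable_fun setT (fun u : R => cos (u + c)).
  by apply: (measurable_cosD c (Y := id)); exact: measurable_id.
rewrite (gaussian_Rintegral mY (sqrtr_ge0 _) (pair_law a b) mf).
rewrite gauss_cosM -gauss_cosD.
by apply: eq_Rintegral => x _; rewrite add0r.
Qed.

Let Rintegral_cos1 (a c : R) :
  \int[P]_w cos (a * Z1 w + c) = cos c * gauss_cos a.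
Proof.
rewrite -[X in _ * X]mulr1 -gauss_cos0 -Rintegral_cos_pair.
by apply: eq_Rintegral => w _; rewrite mul0r addr0.
Qed.

Let Rintegral_cos2 (b c : R) :
  \int[P]_w cos (b * Z2 w + c) = cos c * gauss_cos b.
Proof.
rewrite -[X in _ * X]mul1r -gauss_cos0 -Rintegral_cos_pair.
by apply: eq_Rintegral => w _; rewrite mul0r add0r.
Qed.

(** The product is half a sum of cosines of two linear combinations. As [gauss_cos] is even, both
    carry the factor [gauss_cos a * gauss_cos b], and the phases recombine into [cos c * cos e]. *)
Let Rintegral_cosM (a b c e : R) :
  \int[P]_w (cos (a * Z1 w + c) * cos (b * Z2 w + e)) =
  \int[P]_w cos (a * Z1 w + c) * \int[P]_w cos (b * Z2 w + e).
Proof.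
have mY a' b' : measurable_fun setT (fun w => a' * Z1 w + b' * Z2 w).
  by apply: measurable_funD; exact: measurable_funM.
pose F a' b' c' w := cos (a' * Z1 w + b' * Z2 w + c').
have F_int a' b' c' : P.-integrable setT (EFin \o (F a' b' c')).
  exact: integrable_cosD.
have F2_int a' b' c' : P.-integrable setT (EFin \o (fun w => 2^-1 * F a' b' c' w)).
  apply: (@bounded_integrable _ _ _ _ _ 2^-1).
    by apply: measurable_funM => //; exact: measurable_cosD.
  by move=> w; rewrite normrM ger0_norm ?invr_ge0// ler_piMr ?invr_ge0// cos_max.
transitivity (\int[P]_w (2^-1 * F a b (c + e) w + 2^-1 * F a (- b) (c - e) w)).
  apply: eq_Rintegral => w _; rewrite /F.
  have -> : a * Z1 w + b * Z2 w + (c + e) = (a * Z1 w + c) + (b * Z2 w + e) by ring.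
  have -> : a * Z1 w + - b * Z2 w + (c - e) = (a * Z1 w + c) - (b * Z2 w + e) by ring.
  by move: (a * Z1 w + c) (b * Z2 w + e) => u v; rewrite cosB cosD; field.
rewrite RintegralD// !RintegralZl// !Rintegral_cos_pair gauss_cosN.
rewrite Rintegral_cos1 Rintegral_cos2 cosB cosD.
by move: (gauss_cos a) (gauss_cos b) => x y; field.
Qed.

Let integrable_comp1 f : trig_poly f -> P.-integrable setT (EFin \o (f \o Z1)).
Proof.
move=> /trig_poly_bounded[mf [M fM]].
exact (@bounded_integrable _ _ _ P _ M (measurableT_comp mf mZ1) (fun w => fM _)).
Qed.

Let integrable_comp2 f : trig_poly f -> P.-integrable setT (EFin \o (f \o Z2)).
Proof.
move=> /trig_poly_bounded[mf [M fM]].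
exact (@bounded_integrable _ _ _ P _ M (measurableT_comp mf mZ2) (fun w => fM _)).
Qed.

Let integrable_compM f g : trig_poly f -> trig_poly g ->
  P.-integrable setT (EFin \o (fun w => f (Z1 w) * g (Z2 w))).
Proof.
move=> /trig_poly_bounded[mf [M fM]] /trig_poly_bounded[mg [N gN]].
apply: (@bounded_integrable _ _ _ _ _ (M * N)).
  exact: (measurable_funM (measurableT_comp mf mZ1) (measurableT_comp mg mZ2)).
by move=> w; rewrite normrM ler_pM.
Qed.

Let Rintegral_trig_polyM f g : trig_poly f -> trig_poly g ->
  \int[P]_w (f (Z1 w) * g (Z2 w)) = \int[P]_w f (Z1 w) * \int[P]_w g (Z2 w).
Proof.
move=> tf tg; elim: tf => [k a c|f1 f2 tf1 IH1 tf2 IH2]; last first.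
  have := RintegralD measurableT (integrable_comp1 tf1) (integrable_comp1 tf2).
  rewrite /= => ->; rewrite mulrDl -IH1 -IH2.
  rewrite -(RintegralD measurableT (integrable_compM tf1 tg) (integrable_compM tf2 tg)).
  by apply: eq_Rintegral => w _; rewrite mulrDl.
elim: tg => [k' b e|g1 g2 tg1 IH1 tg2 IH2]; last first.
  have tf := trig_poly_cos k a c.
  have := RintegralD measurableT (integrable_comp2 tg1) (integrable_comp2 tg2).
  rewrite /= => ->; rewrite mulrDr -IH1 -IH2.
  rewrite -(RintegralD measurableT (integrable_compM tf tg1) (integrable_compM tf tg2)).
  by apply: eq_Rintegral => w _; rewrite mulrDr.
have i1 : P.-integrable setT (EFin \o (fun w => cos (a * Z1 w + c))).
  by apply: integrable_cosD; exact: measurable_funM.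
have i2 : P.-integrable setT (EFin \o (fun w => cos (b * Z2 w + e))).
  by apply: integrable_cosD; exact: measurable_funM.
have i12 : P.-integrable setT
    (EFin \o (fun w => cos (a * Z1 w + c) * cos (b * Z2 w + e))).
  apply: (@bounded_integrable _ _ _ _ _ 1).
    by apply: measurable_funM; apply: measurable_cosD; exact: measurable_funM.
  by move=> w; rewrite normrM mulr_ile1// cos_max.
rewrite (RintegralZl k measurableT i1) (RintegralZl k' measurableT i2) mulrACA.
rewrite -Rintegral_cosM -(RintegralZl (k * k') measurableT i12).
by apply: eq_Rintegral => w _; rewrite mulrACA.
Qed.

(** Measurability and the bound 1 are included so that dominated convergence makes the class closed
    under pointwise limits. *)
Let uncorrelated (f : R -> R) := [/\ measurable_fun setT f, forall y, `|f y| <= 1 &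
  \int[P]_w (f (Z1 w) * f (Z2 w)) = \int[P]_w f (Z1 w) * \int[P]_w f (Z2 w)].

Let uncorrelated_cvg (f_ : nat -> R -> R) (f : R -> R) :
  (forall n, uncorrelated (f_ n)) -> (forall y, f_ n y @[n --> \oo] --> f y) ->
  uncorrelated f.
Proof.
move=> Hf ff; have mf_ n : measurable_fun setT (f_ n) by have [] := Hf n.
have f1 n y : `|f_ n y| <= 1 by have [_ /(_ y)] := Hf n.
have mf : measurable_fun setT f by apply: (measurable_fun_cvg mf_) => y _; exact: ff.
split=> // [y|]; first by apply: (cvgr_to_le (cvg_norm (ff y))); exact: nearW.
have c1 : \int[P]_w f_ n (Z1 w) @[n --> \oo] --> \int[P]_w f (Z1 w).
  apply: cvg_Rintegral_bounded => // n.
  exact: (measurableT_comp (mf_ n) mZ1).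
have c2 : \int[P]_w f_ n (Z2 w) @[n --> \oo] --> \int[P]_w f (Z2 w).
  apply: cvg_Rintegral_bounded => // n.
  exact: (measurableT_comp (mf_ n) mZ2).
have c12 : \int[P]_w (f_ n (Z1 w) * f_ n (Z2 w)) @[n --> \oo] -->
    \int[P]_w (f (Z1 w) * f (Z2 w)).
  apply: cvg_Rintegral_bounded => [n|n w|w].
  - exact: (measurable_funM (measurableT_comp (mf_ n) mZ1)
      (measurableT_comp (mf_ n) mZ2)).
  - by rewrite normrM mulr_ile1.
  - exact: cvgM.
have E : (fun n => \int[P]_w (f_ n (Z1 w) * f_ n (Z2 w))) =
    (fun n => \int[P]_w f_ n (Z1 w) * \int[P]_w f_ n (Z2 w)).
  by apply/funext => n; have [] := Hf n.
rewrite E in c12.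
exact: (cvg_unique _ c12 (cvgM c1 c2)).
Qed.

(** Two nested limits: at fixed frequency [k.+1%:R^-1] the steep waves tend to the indicator of a
    positive sine, and these indicators tend to that of the half-line as [k] grows. *)
Lemma gaussian_pair_tail (t : R) :
  \int[P]_w ((t < Z1 w)%R%:R * (t < Z2 w)%R%:R) =
  \int[P]_w (t < Z1 w)%R%:R * \int[P]_w (t < Z2 w)%R%:R.
Proof.
suff [] : uncorrelated (fun y : R => (t < y)%R%:R) by [].
apply: (uncorrelated_cvg (f_ := fun n y =>
  (0 < sin (n.+1%:R^-1 * (y - t)))%R%:R)); last exact: cvg_sin_sign.
move=> k; apply: (uncorrelated_cvg (f_ := steep_wave k.+1%:R^-1 t)); last first.
  exact: cvg_steep_wave.
move=> n; have tw := trig_poly_steep_wave k.+1%:R^-1 t n.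
split; [by have [] := trig_poly_bounded tw|exact: steep_wave_bounded|].
exact: Rintegral_trig_polyM.
Qed.

End uncorrelated_gaussian_pair.

(** * Tail and quantiles of the standard normal law *)

Section normal_tail.
Context {R : realType}.
Implicit Types (x y p : R).
Local Notation gamma := (normal_prob (0 : R) 1).
Local Notation lambda := (@lebesgue_measure R).

Definition tail x : R := fine (gamma `]x, +oo[).

Lemma tailE x : gamma `]x, +oo[ = (tail x)%:E.
Proof. by rewrite /tail fineK// fin_num_measure. Qed.

Lemma PhiE x : gamma `]-oo, x] = (Phi x)%:E.
Proof. by rewrite /Phi fineK// fin_num_measure. Qed.

Lemma tail_ge0 x : 0 <= tail x.
Proof. by rewrite fine_ge0. Qed.

Lemma tail_nonincreasing : {homo tail : x y /~ x <= y}.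
Proof.
move=> x y xy; rewrite -lee_fin -!tailE le_measure ?inE//.
exact: subitvPl.
Qed.

Lemma PhiD_tail x : Phi x + tail x = 1.
Proof.
apply: EFin_inj; rewrite EFinD -PhiE -tailE -measureU//.
- by rewrite -(probability_setT gamma) itv_setU_setT.
- apply/seteqP; split => // y [/=]; rewrite !in_itv/= andbT => yx xy.
  by move: (le_lt_trans yx xy); rewrite ltxx.
Qed.

Lemma normal_prob_itvcy x : gamma `[x, +oo[ = gamma `]x, +oo[.
Proof.
rewrite -(@setU1itv _ _ _ x false)// measureU//.
  rewrite [X in (X + _)%E](_ : _ = 0%E) ?add0e//.
  have /null_content_dominatesP := normal_prob_dominates (0 : R) 1.
  by apply => //; exact: lebesgue_measure_set1.
by apply/seteqP; split => // y [/= ->]; rewrite in_itv/= ltxx.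
Qed.

Lemma tailN x : tail (- x) = Phi x.
Proof.
apply: EFin_inj; rewrite -tailE -PhiE -normal_prob_itvcy -normal_probN//.
congr (gamma _); apply/seteqP; split => y /=; rewrite !in_itv/= andbT.
  by rewrite lerN2.
by rewrite lerN2.
Qed.

(** Translate by [e] and compare densities: for [y > x], the exponent [(y + e)^2 / 2] is at least
    [y^2 / 2 + x e]. *)
Lemma tail_shift x e : 0 <= e -> tail (x + e) <= expR (- (x * e)) * tail x.
Proof.
move=> e0; rewrite -lee_fin EFinM -!tailE /normal_prob.
have mpdf : measurable_fun setT (EFin \o normal_pdf (0 : R) 1).
  by apply/measurable_EFinP; exact: measurable_normal_pdf.
have pdf0 (y : R) : (0 <= (normal_pdf (0 : R) 1 y)%:E)%E.
  by rewrite lee_fin normal_pdf_ge0.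
rewrite -ge0_integralZl ?lee_fin ?expR_ge0//; last exact: measurable_funTS.
rewrite (@ge0_integral_affine _ e 1 ltr01)//.
rewrite (_ : _ @^-1` _ = `]x, +oo[%classic); last first.
  apply/seteqP; split => y; rewrite /affine/= !in_itv/= !andbT mul1r; lra.
apply: ge0_le_integral => //=.
- by move=> y _; rewrite mule_ge0.
- apply: measurable_funTS; apply: measurable_funeM.
  by apply: (measurableT_comp mpdf); exact: measurable_affine.
- by apply: measurable_funTS; exact: measurable_funeM.
- move=> y; rewrite in_itv/= andbT => xy.
  rewrite !mul1r -EFinM lee_fin !mul1r !normal_pdfE ?oner_neq0// /normal_fun.
  rewrite mulrCA ler_wpM2l ?normal_peak_ge0// -expRD ler_expR !subr0 expr1n.
  have : 0 <= (y - x) * e by rewrite mulr_ge0// subr_ge0 ltW.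
  have : 0 <= e ^+ 2 by exact: sqr_ge0.
  by rewrite !expr2; lra.
Qed.

Lemma tail_lt_small p : 0 < p -> exists2 x, 0 < x & tail x < p.
Proof.
(* Shifting 1 by [p^-1] gives a tail of at most [expR (- p^-1)], which is below [p] because
   [expR p^-1 > p^-1]. *)
move=> p0; exists (1 + p^-1); first by rewrite addr_gt0 ?invr_gt0.
have ip : 0 <= p^-1 by rewrite invr_ge0 ltW.
apply: le_lt_trans (tail_shift 1 ip) _; rewrite mul1r.
have t1 : tail 1 <= 1.
  by rewrite -lee_fin -tailE probability_le1.
apply: (@le_lt_trans _ _ (expR (- p^-1))); first by rewrite ler_piMr ?expR_ge0.
rewrite expRN -[ltRHS]invrK ltf_pV2 ?posrE ?expR_gt0 ?invr_gt0//.
by apply: lt_le_trans (expR_ge1Dx _); rewrite ltrDr.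
Qed.

Lemma tail_itv x y : x <= y -> tail x = tail y + fine (gamma `]x, y]).
Proof.
move=> xy; apply: EFin_inj; rewrite EFinD -!tailE fineK ?fin_num_measure//.
rewrite addeC -measureU//.
  congr (gamma _); apply/seteqP; split => z /=; rewrite !in_itv/= !andbT.
    by move=> xz; have [zy|yz] := leP z y; [left; rewrite xz|right].
  by case=> [/andP[]//|]; exact: le_lt_trans.
apply/seteqP; split => // z [/=]; rewrite !in_itv/= andbT => /andP[_ zy] yz.
by move: (le_lt_trans zy yz); rewrite ltxx.
Qed.

(** The density is bounded by its peak. *)
Lemma tail_lipschitz x y : `|tail x - tail y| <= normal_peak 1 * `|x - y|.
Proof.
wlog xy : x y / x <= y.
  by move=> H; case/orP: (le_total x y) => [/H//|/H]; rewrite distrC (distrC y).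
have T := tail_nonincreasing xy.
rewrite ger0_norm ?subr_ge0// ler0_norm ?subr_le0// opprB (tail_itv xy) addrC addKr.
rewrite -lee_fin fineK ?fin_num_measure// /normal_prob.
apply: (@le_trans _ _ (\int[lambda]_(z in `]x, y]) (cst (normal_peak 1)%:E z))%E).
  apply: ge0_le_integral => //=.
  - by move=> z _; rewrite lee_fin normal_pdf_ge0.
  - apply: measurable_funTS; apply/measurable_EFinP; exact: measurable_normal_pdf.
  - by move=> z _; rewrite lee_fin normal_pdf_ub// oner_neq0.
rewrite integral_cst//= lebesgue_measure_itv/= lte_fin; case: ltP => _.
  by rewrite -EFinB -EFinM lee_fin.
by rewrite mule0 lee_fin mulr_ge0 ?normal_peak_ge0// subr_ge0.
Qed.

Lemma continuous_tail : continuous tail.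
Proof.
have k0 : 0 < normal_peak (1 : R) by rewrite normal_peak_gt0 ?oner_neq0.
move=> x; apply/cvgrPdist_lt => e e0; near=> y.
apply: le_lt_trans (tail_lipschitz x y) _.
rewrite mulrC -ltr_pdivlMr//.
near: y; apply: (@cvgr_dist_lt _ _ _ (nbhs x)); last by rewrite divr_gt0.
exact: cvg_id.
Unshelve. all: by end_near. Qed.

Lemma tail_gt0 x : 0 < tail x.
Proof.
(* On the interval from [x] to [x + 1] squares are at most [M], so the density is at least [c]
   there. *)
pose M := (`|x| + 1) ^+ 2.
pose c := normal_peak 1 * expR (- M / 2).
have c0 : 0 < c by rewrite mulr_gt0 ?expR_gt0// normal_peak_gt0 ?oner_neq0.
have x1 : x <= x + 1 by rewrite lerDl.
rewrite (tail_itv x1); apply: ltr_wpDl; first exact: tail_ge0.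
apply: (lt_le_trans c0); rewrite -lee_fin fineK ?fin_num_measure// /normal_prob.
apply: (@le_trans _ _ (\int[lambda]_(z in `]x, (x + 1)%R]) (cst c%:E z))%E).
  rewrite integral_cst//= lebesgue_measure_itv/= lte_fin ltrDl ltr01.
  by rewrite -EFinB -EFinM lee_fin addrAC subrr add0r mulr1.
apply: ge0_le_integral => //=.
- by move=> z _; rewrite lee_fin ltW.
- apply: measurable_funTS; apply/measurable_EFinP; exact: measurable_normal_pdf.
- move=> z; rewrite in_itv/= => /andP[xz zx].
  rewrite lee_fin normal_pdfE ?oner_neq0// /normal_fun ler_wpM2l ?normal_peak_ge0//.
  rewrite ler_expR subr0 expr1n ler_wpM2r ?invr_ge0 ?ler0n// lerN2 /M.
  rewrite -(real_normK (num_real z)) ler_sqr ?nnegrE ?addr_ge0// ler_norml.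
  have := ler_norm x; have := ler_norm (- x); rewrite normrN => ? ?.
  by apply/andP; split; lra.
Qed.

(** By [pinvK] it suffices that [p] is a value of [Phi]. The intermediate value theorem for [tail]
    yields a point [c] with [tail c = p], and [Phi (- c) = tail c]. *)
Lemma Phi_invK p : 0 < p < 1 -> Phi (Phi_inv p) = p.
Proof.
move=> /andP[p0 p1]; rewrite /Phi_inv pinvK// inE.
have q0 : 0 < 1 - p by rewrite subr_gt0.
have [a a0 Ta] := tail_lt_small p0; have [b b0 Tb] := tail_lt_small q0.
have Tp : tail (- b) > p.
  by have := PhiD_tail b; rewrite tailN; lra.
have [|||c _ Tc] := @IVT R tail (- b) a p.
- by rewrite (@le_trans _ _ 0)// ?oppr_le0 ltW.
- by apply: continuous_subspaceT; exact: continuous_tail.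
- by rewrite ge_min (ltW Ta) orbT/= le_max (ltW Tp).
by exists (- c) => //; rewrite -tailN opprK.
Qed.

Lemma tail_NPhi_inv p : 0 < p < 1 -> tail (- Phi_inv p) = p.
Proof. by move=> p01; rewrite tailN Phi_invK. Qed.

Lemma tail_Phi_inv p : 0 < p < 1 -> tail (Phi_inv (1 - p)) = p.
Proof.
move=> p01; have := PhiD_tail (Phi_inv (1 - p)).
rewrite Phi_invK; first lra.
by case/andP: p01 => ? ?; apply/andP; split; lra.
Qed.

End normal_tail.

(** * Integrability of finite sums and of products *)

Section integrals_of_sums.
Context d (T : measurableType d) (R : realType) (P : probability T R).

Lemma Rintegral_sum (I : Type) (r : seq I) (f : I -> T -> R) :
  (forall i, P.-integrable setT (EFin \o f i)) ->
  P.-integrable setT (EFin \o (fun w => \sum_(i <- r) f i w)) /\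
  \int[P]_w (\sum_(i <- r) f i w) = \sum_(i <- r) \int[P]_w f i w.
Proof.
move=> fi; elim: r => [|i r [IHi IHs]].
  have -> : (fun w => \sum_(i <- [::]) f i w) = fun=> 0.
    by apply/funext => w; rewrite big_nil.
  rewrite big_nil Rintegral_probability_cst; split => //.
  by apply: (@bounded_integrable _ _ _ _ _ 0) => // w; rewrite normr0.
have -> : (fun w => \sum_(j <- i :: r) f j w) =
    fun w => f i w + \sum_(j <- r) f j w.
  by apply/funext => w; rewrite big_cons.
rewrite big_cons -IHs; split; last exact: RintegralD.
by have := integrableD measurableT (fi i) IHi; apply: eq_integrable.
Qed.

(** The absolute value of a product is at most the sum of the squares. *)
Lemma integrable_mul_of_sqr (f g : T -> R) :
  measurable_fun setT f -> measurable_fun setT g ->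
  P.-integrable setT (EFin \o (fun w => f w ^+ 2)) ->
  P.-integrable setT (EFin \o (fun w => g w ^+ 2)) ->
  P.-integrable setT (EFin \o (fun w => f w * g w)).
Proof.
move=> mf mg fi gi.
have H : P.-integrable setT (EFin \o (fun w => f w ^+ 2 + g w ^+ 2)).
  by have := integrableD measurableT fi gi; apply: eq_integrable.
apply: (le_integrable measurableT _ _ H).
  by apply/measurable_EFinP; exact: measurable_funM.
move=> w _ /=; rewrite lee_fin normrM.
rewrite [leRHS]ger0_norm ?addr_ge0 ?sqr_ge0//.
rewrite -(real_normK (num_real (f w))) -(real_normK (num_real (g w))).
have := sqr_ge0 (`|f w| - `|g w|); have := sqr_ge0 (`|f w| + `|g w|).
by rewrite sqrrD sqrrB; lra.
Qed.

Lemma integrable_of_sqr (f : T -> R) : measurable_fun setT f ->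
  P.-integrable setT (EFin \o (fun w => f w ^+ 2)) ->
  P.-integrable setT (EFin \o f).
Proof.
move=> mf fi; have := @integrable_mul_of_sqr f (fun=> 1) mf.
rewrite (_ : (fun w => f w * 1) = f); last by apply/funext => w; rewrite mulr1.
apply=> //; apply: (@bounded_integrable _ _ _ _ _ 1) => // w.
by rewrite expr1n normr1.
Qed.

End integrals_of_sums.

(** * Mean and variance of linear combinations of the observations *)

Section linear_combinations.
Context d (T : measurableType d) (R : realType) (P : probability T R).
Variables (rho : R) (X : nat -> {RV P >-> R}) (mu : nat -> R).
Hypotheses (rho_gt0 : 0 < rho) (rho_lt1 : rho < 1).
Hypothesis X_gauss : jointly_gaussian P X.
Hypothesis X_law : forall i : nat, has_gaussian_law P (X i) (mu i) 1.
Hypothesis X_corr : forall i j : nat, i != j -> correlation P (X i) (X j) = rho.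
Local Notation gamma := (normal_prob (0 : R) 1).

Let mX i : measurable_fun setT (X i).
Proof. exact: measurable_funPT. Qed.

(** From [x^2 <= 2 ((x - c)^2 + c^2)]. The shift is there because the variance of [X 0] is centered
    at an expectation not yet known to be [mu 0]. *)
Let gamma_sqr_shift c :
  gamma.-integrable setT (fun x => ((x - c) ^+ 2)%:E) ->
  gamma.-integrable setT (EFin \o (fun x => x ^+ 2)).
Proof.
move=> ci; have cst_i : gamma.-integrable setT (EFin \o (fun=> c ^+ 2)).
  exact (@bounded_integrable _ _ _ gamma _ `|c ^+ 2|
    (@measurable_cst _ _ _ _ _ _) (fun=> lexx _)).
have H : gamma.-integrable setT (EFin \o (fun x => 2 * ((x - c) ^+ 2 + c ^+ 2))).
  have := integrableZl measurableT 2 (integrableD measurableT ci cst_i).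
  by apply: eq_integrable.
apply: (le_integrable measurableT _ _ H).
  by apply/measurable_EFinP; exact: measurable_funX.
move=> x _ /=; rewrite lee_fin [leLHS]ger0_norm ?sqr_ge0// [leRHS]ger0_norm; last first.
  by rewrite mulr_ge0// addr_ge0 ?sqr_ge0.
have := sqr_ge0 (x - 2 * c); rewrite !expr2; lra.
Qed.

Let mean_id : gamma.-integrable setT (EFin \o (fun x => x ^+ 2)) ->
  \int[gamma]_x x = 0.
Proof.
move=> i2.
have i1 : gamma.-integrable setT (EFin \o id).
  exact (integrable_of_sqr (@measurable_id _ (measurableTypeR R) _) i2).
have E : \int[gamma]_x x = - \int[gamma]_x x.
  rewrite -mulN1r -(RintegralZl (-1) measurableT i1); congr fine.
  rewrite -[LHS]integral_normal_probN; last exact/measurable_EFinP.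
  by apply: eq_integral => x _; rewrite mulN1r.
by move: (\int[gamma]_x x) E => z E; lra.
Qed.

Let m_sqr (c : R) : measurable_fun setT (fun x : R => ((x - c) ^+ 2)%:E).
Proof.
apply/measurable_EFinP; apply: measurable_funX.
by apply: measurable_funB => //; exact: measurable_id.
Qed.

(* A correlation [rho != 0] forces the variance of [X 0] to be finite: [fine]
   sends an infinite variance to 0, and division by 0 gives 0. *)
Let integrable_sqr : gamma.-integrable setT (EFin \o (fun x => x ^+ 2)).
Proof.
have V0 : fine ('V_P[X 0%N]) != 0.
  apply/eqP => V0; have := X_corr (isT : 0%N != 1%N).
  by rewrite /correlation V0 sqrtr0 mul0r invr0 mulr0 => /eqP; rewrite lt_eqF.
pose e := fine ('E_P[X 0%N]).
have VE : ('V_P[X 0%N] = \int[P]_w ((X 0%N w - e) ^+ 2)%:E)%E.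
  rewrite /variance unlock /e.
  by move: (fine 'E_P[X 0%N]) => z; rewrite unlock.
apply: (@gamma_sqr_shift (e - mu 0%N)).
have := gaussian_integral (mX 0) ler01 (X_law 0%N) (m_sqr e).
rewrite -VE => VE'.
apply/integrableP; split.
  exact: m_sqr.
rewrite (_ : (\int[gamma]_x _)%E = 'V_P[X 0%N]).
  rewrite -ge0_fin_numE; last exact: variance_ge0.
  by move: V0; case: ('V_P[X 0%N]) => //=; rewrite eqxx.
rewrite VE'; apply: eq_integral => x _.
rewrite gee0_abs ?lee_fin ?sqr_ge0// mul1r; congr ((_ ^+ 2)%:E).
by rewrite opprB addrCA addrA.
Qed.

Let integrable_id : gamma.-integrable setT (EFin \o id).
Proof.
exact (integrable_of_sqr (@measurable_id _ (measurableTypeR R) _) integrable_sqr).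
Qed.

Let Rintegral_affine m s : \int[gamma]_x (m + s * x) = m.
Proof.
have ci : gamma.-integrable setT (EFin \o (fun=> m)).
  exact (@bounded_integrable _ _ _ gamma _ `|m|
    (@measurable_cst _ _ _ _ _ _) (fun=> lexx _)).
have si : gamma.-integrable setT (EFin \o (fun x => s * x)).
  by have := integrableZl measurableT s integrable_id; apply: eq_integrable.
rewrite (RintegralD measurableT ci si) (RintegralZl s measurableT integrable_id).
by rewrite (mean_id integrable_sqr) mulr0 addr0 Rintegral_probability_cst.
Qed.

(** The second moment of the standard normal law. It is kept as a symbol and cancels from the
    covariance identities by [v_neq0]. *)
Let v := \int[gamma]_x (x ^+ 2).

Let Rintegral_scale_sqr s : \int[gamma]_x ((s * x) ^+ 2) = s ^+ 2 * v.
Proof.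
rewrite -(RintegralZl (s ^+ 2) measurableT integrable_sqr).
by apply: eq_Rintegral => x _; rewrite exprMn.
Qed.

Let expectation_X i : 'E_P[X i]%E = (mu i)%:E.
Proof.
have mi : measurable_fun setT (EFin : R -> \bar R) by exact: EFin_measurable.
rewrite expectation_def (gaussian_integral (mX i) ler01 (X_law i) mi).
have ci : gamma.-integrable setT (EFin \o (fun=> mu i)).
  exact (@bounded_integrable _ _ _ gamma _ `|mu i|
    (@measurable_cst _ _ _ _ _ _) (fun=> lexx _)).
have si : gamma.-integrable setT (EFin \o (fun x => 1 * x)).
  by have := integrableZl measurableT 1 integrable_id; apply: eq_integrable.
have H : gamma.-integrable setT (EFin \o (fun x => mu i + 1 * x)).
  by have := integrableD measurableT ci si; apply: eq_integrable.
by rewrite (EFin_Rintegral H) Rintegral_affine.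
Qed.

Let D i w := X i w - mu i.

Let mD i : measurable_fun setT (D i).
Proof. by apply: measurable_funB. Qed.

Let integrable_D_sqr i : P.-integrable setT (EFin \o (fun w => D i w ^+ 2)).
Proof.
have [_ H] := gaussian_integrable (mX i) ler01 (X_law i) (m_sqr (mu i)).
apply: H; move: integrable_sqr; apply: eq_integrable => // x _ /=.
by rewrite mul1r addrC addKr.
Qed.

Let integrable_DD i j : P.-integrable setT (EFin \o (fun w => D i w * D j w)).
Proof. exact: integrable_mul_of_sqr. Qed.

Let covariance_X i j :
  fine (covariance P (X i) (X j)) = \int[P]_w (D i w * D j w).
Proof. by rewrite unlock !expectation_X unlock. Qed.

Let Rintegral_D_sqr i : \int[P]_w (D i w * D i w) = v.
Proof.
have mf : measurable_fun setT (fun x : R => (x - mu i) ^+ 2).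
  by have /measurable_EFinP := m_sqr (mu i).
transitivity (\int[P]_w ((X i w - mu i) ^+ 2)); first by [].
rewrite (gaussian_Rintegral (mX i) ler01 (X_law i) mf).
by apply: eq_Rintegral => x _; rewrite mul1r addrC addKr.
Qed.

(** Otherwise the correlation would be a division by 0, hence 0, contradicting [0 < rho]. *)
Let v_neq0 : v != 0.
Proof.
apply/eqP => v0; have := X_corr (isT : 0%N != 1%N).
rewrite /correlation /variance !covariance_X !Rintegral_D_sqr v0.
by rewrite sqrtr0 mul0r invr0 mulr0 => /eqP; rewrite lt_eqF.
Qed.

Let v_ge0 : 0 <= v.
Proof. by apply: Rintegral_ge0 => x _; rewrite sqr_ge0. Qed.

Let Rintegral_DD i j : \int[P]_w (D i w * D j w) =
  (rho + (1 - rho) * (i == j)%:R) * v.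
Proof.
have [->|ij] := eqVneq i j; first by rewrite Rintegral_D_sqr mulr1 addrC subrK mul1r.
rewrite mulr0 addr0 -(X_corr ij) /correlation /variance !covariance_X.
by rewrite !Rintegral_D_sqr -expr2 sqr_sqrtr// divfK.
Qed.

(** Joint normality yields a Gaussian law with unknown parameters [m] and [s]; the first two
    moments, computed from [mu] and [rho], identify them. *)
Lemma linear_combination_law n (a : 'I_n -> R) :
  has_gaussian_law P (fun w => \sum_(i < n) a i * X i w)
    (\sum_(i < n) a i * mu i)
    (Num.sqrt ((1 - rho) * \sum_(i < n) a i ^+ 2 + rho * (\sum_(i < n) a i) ^+ 2)).
Proof.
have [m [s [s_ge0 law]]] := X_gauss a.
set Y := (fun w => _) in law.
have mY : measurable_fun setT Y.
  by apply: measurable_sum => i; exact: measurable_funM.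
pose M := \sum_(i < n) a i * mu i; pose Z w := \sum_(i < n) a i * D i w.
have YZ w : Y w - M = Z w.
  by rewrite /Y /M /Z -sumrB; apply: eq_bigr => i _; rewrite mulrBr.
have D_int i : P.-integrable setT (EFin \o D i) by exact: integrable_of_sqr.
have aD_int i : P.-integrable setT (EFin \o (fun w => a i * D i w)).
  by have := integrableZl measurableT (a i) (D_int i); apply: eq_integrable.
have [_ Z0] := Rintegral_sum (index_enum 'I_n) aD_int.
have mB : measurable_fun setT (fun x : R => x - M).
  by apply: measurable_funB => //; exact: measurable_id.
have D0 i : \int[P]_w D i w = 0.
  have mB' : measurable_fun setT (fun x : R => x - mu i).
    by apply: measurable_funB => //; exact: measurable_id.
  rewrite (gaussian_Rintegral (mX i) ler01 (X_law i) mB').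
  rewrite -[RHS](Rintegral_affine 0 1).
  by apply: eq_Rintegral => x _; rewrite addrAC subrr.
have mE : m = M.
  have H := gaussian_Rintegral mY s_ge0 law mB.
  have : \int[P]_w (Y w - M) = 0.
    under eq_Rintegral do rewrite YZ.
    rewrite Z0 big1// => i _.
    by rewrite RintegralZl// D0 mulr0.
  rewrite H => E; apply/eqP; rewrite -subr_eq0 -E -[X in X == _](Rintegral_affine _ s).
  by apply/eqP/eq_Rintegral => x _; rewrite addrAC.
(* Multiplied by [v], both sides are the second moment of [Y - M]: the left one by its law, the
   right one by expanding the square into covariances. *)
have sE : s ^+ 2 = (1 - rho) * \sum_(i < n) a i ^+ 2 + rho * (\sum_(i < n) a i) ^+ 2.
  apply: (mulIf v_neq0); rewrite -Rintegral_scale_sqr.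
  have mB2 : measurable_fun setT (fun x : R => (x - M) ^+ 2).
    by have /measurable_EFinP := m_sqr M.
  transitivity (\int[P]_w ((Y w - M) ^+ 2)).
    rewrite (gaussian_Rintegral mY s_ge0 law mB2).
    by apply: eq_Rintegral => x _; rewrite mE addrC addKr.
  pose F (p : 'I_n * 'I_n) w := a p.1 * a p.2 * (D p.1 w * D p.2 w).
  have F_int p : P.-integrable setT (EFin \o F p).
    have := integrableZl measurableT (a p.1 * a p.2) (integrable_DD p.1 p.2).
    by apply: eq_integrable.
  have [_ FE] := Rintegral_sum (index_enum ('I_n * 'I_n)%type) F_int.
  transitivity (\int[P]_w (\sum_(p <- index_enum ('I_n * 'I_n)%type) F p w)).
    apply: eq_Rintegral => w _; rewrite YZ expr2 big_distrlr/= pair_bigA/=.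
    by apply: eq_bigr => p _; rewrite mulrACA.
  rewrite FE; transitivity (\sum_(i < n) \sum_(j < n)
      a i * a j * ((rho + (1 - rho) * (i == j)%:R) * v)).
    rewrite pair_bigA/=; apply: eq_bigr => p _.
    by rewrite RintegralZl// Rintegral_DD.
  pose S := \sum_(i < n) a i.
  have inner i : \sum_(j < n) a i * a j * ((rho + (1 - rho) * (i == j)%:R) * v) =
      rho * v * (a i * S) + (1 - rho) * v * a i ^+ 2.
    transitivity (\sum_(j < n) (rho * v * a i * a j +
        (if j == i then (1 - rho) * v * a i ^+ 2 else 0))).
      by apply: eq_bigr => j _; rewrite (eq_sym i); case: eqVneq => [->|_] /=; ring.
    rewrite big_split/= -mulr_sumr -big_mkcond/= big_pred1_eq -/S.
    ring.
  rewrite (eq_bigr _ (fun i _ => inner i)) big_split/= -!mulr_sumr -mulr_suml -/S.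
  ring.
by rewrite -sE sqrtr_sqr ger0_norm// -/M -mE.
Qed.

End linear_combinations.

(** * Exceedances of a level by finitely many variables *)

Section gaussian_tail_events.
Context d (T : measurableType d) (R : realType) (P : probability T R).

Lemma measurable_gt_set (Z : T -> R) (x : R) : measurable_fun setT Z ->
  measurable [set w | x < Z w].
Proof.
move=> mZ; rewrite (_ : [set w | _] = Z @^-1` `]x, +oo[).
  by rewrite -[X in measurable X]setTI; exact: mZ.
by apply/seteqP; split => w /=; rewrite in_itv/= andbT.
Qed.

Lemma gaussian_tail (Y : T -> R) (s x : R) : 0 < s ->
  has_gaussian_law P Y 0 s -> P [set w | x < Y w] = (tail (x / s))%:E.
Proof.
move=> s0 law; rewrite (_ : [set w | _] = Y @^-1` `]x, +oo[); last first.
  by apply/seteqP; split => w /=; rewrite in_itv/= andbT.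
rewrite -tailE; apply: etrans (law _ _) _; first exact: measurable_itv.
rewrite gaussian_law_affine ?ltW//; congr (normal_prob _ _ _).
apply/seteqP; split => y; rewrite /affine/= !in_itv/= !andbT add0r.
  by rewrite ltr_pdivrMr// mulrC.
by rewrite ltr_pdivrMr// mulrC.
Qed.

Lemma Rintegral_gt (Z : T -> R) (x : R) : measurable_fun setT Z ->
  \int[P]_w (x < Z w)%R%:R = fine (P [set w | x < Z w]).
Proof.
move=> mZ; have mA := measurable_gt_set x mZ.
congr fine; rewrite -[in RHS](setIT [set w | x < Z w]) -integral_indic//.
by apply: eq_integral => w _; rewrite indicE mem_setE.
Qed.

(** The union bound, by induction on an enumeration. *)
Lemma exceedance_le (I : finType) (A : {set I}) (Z : I -> T -> R) (s p : R) :
  (forall i, measurable_fun setT (Z i)) ->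
  (forall i, i \in A -> P [set w | s < Z i w] = p%:E) ->
  (P [set w | exists2 i, i \in A & (s < Z i w)%R] <= (#|A|%:R * p)%:E)%E.
Proof.
move=> mZ PE; pose F i := [set w | s < Z i w].
have mF i : measurable (F i) by exact: measurable_gt_set.
have -> : [set w | exists2 i, i \in A & s < Z i w] =
    \big[setU/set0]_(i <- enum A) F i.
  rewrite -bigcup_seq; apply/seteqP; split => w [i iA siw]; exists i => //=.
    by rewrite mem_enum.
  by move: iA => /=; rewrite mem_enum.
have sub r : measurable (\big[setU/set0]_(i <- r) F i) /\
    (P (\big[setU/set0]_(i <- r) F i) <= \sum_(i <- r) (P (F i)))%E.
  elim: r => [|i r [mr IH]]; first by rewrite !big_nil measure0.
  rewrite !big_cons; split; first exact: measurableU.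
  have U2 := @measureU2 _ _ _ P _ _ (mF i) mr.
  by apply: (le_trans U2); rewrite leeD2l.
apply: le_trans (sub _).2 _.
rewrite big_enum/= (eq_bigr (fun=> p%:E)); last by move=> i iA; exact: PE.
by rewrite sumEFin sumr_const mulr_natl.
Qed.

(* Chebyshev's inequality for the number of exceedances. *)
Lemma no_exceedance_le (I : finType) (A : {set I}) (Z : I -> T -> R) (s p : R)
    (N := #|A|%:R : R) :
  (forall i, measurable_fun setT (Z i)) ->
  (forall i, i \in A -> \int[P]_w (s < Z i w)%R%:R = p) ->
  (forall i j, i \in A -> j \in A -> i != j ->
    \int[P]_w ((s < Z i w)%R%:R * (s < Z j w)%R%:R) = p * p) ->
  0 < N * p ->
  (P (~` [set w | exists2 i, i \in A & (s < Z i w)%R]) <= ((N * p)^-1)%:E)%E.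
Proof.
move=> mZ pE ppE Np0.
pose F i w : R := (s < Z i w)%R%:R.
have F1 i w : `|F i w| <= 1 by rewrite /F; case: (_ < _)%R; rewrite ?normr1 ?normr0.
have mF i : measurable_fun setT (F i).
  rewrite (_ : F i = \1_[set w | s < Z i w]).
    by apply: measurable_indic; exact: measurable_gt_set.
  by apply/funext => w; rewrite indicE mem_setE.
(* Centered indicators, set to 0 outside [A] so that sums can range over all of [I]. *)
pose G i w := (i \in A)%:R * (F i w - p).
have mG i : measurable_fun setT (G i).
  by apply: measurable_funM => //; exact: measurable_funB.
have G1 i w : `|G i w| <= 1 + `|p|.
  rewrite normrM; apply: le_trans (_ : 1 * `|F i w - p| <= _).
    by rewrite ler_wpM2r//; case: (_ \in _); rewrite ?normr1 ?normr0.
  by rewrite mul1r (le_trans (ler_normB _ _))// lerD2r.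
have GG_int q : P.-integrable setT (EFin \o (fun w => G q.1 w * G q.2 w)).
  apply: (@bounded_integrable _ _ _ _ _ ((1 + `|p|) * (1 + `|p|))).
    exact: measurable_funM.
  by move=> w; rewrite normrM ler_pM.
have GGE i j : \int[P]_w (G i w * G j w) =
    if (i == j) && (i \in A) then p - p ^+ 2 else 0.
  have Fi k c : P.-integrable setT (EFin \o (fun w => c * F k w)).
    apply: (@bounded_integrable _ _ _ _ _ `|c|); first exact: measurable_funM.
    by move=> w; rewrite normrM ler_piMr.
  have FFi k l : P.-integrable setT (EFin \o (fun w => F k w * F l w)).
    apply: (@bounded_integrable _ _ _ _ _ 1); first exact: measurable_funM.
    by move=> w; rewrite normrM mulr_ile1.
  have ci c : P.-integrable setT (EFin \o (fun=> c)).
    by apply: (@bounded_integrable _ _ _ _ _ `|c|).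
  have [iA|iA] := boolP (i \in A); last first.
    rewrite andbF -[RHS](Rintegral_probability_cst P); apply: eq_Rintegral => w _.
    by rewrite /G (negbTE iA) !mul0r.
  rewrite andbT; have [jA|jA] := boolP (j \in A); last first.
    rewrite (_ : (i == j) = false); last by apply: contraNF jA => /eqP <-.
    rewrite -[RHS](Rintegral_probability_cst P); apply: eq_Rintegral => w _.
    by rewrite /G (negbTE jA) mul0r mulr0.
  transitivity (\int[P]_w ((F i w * F j w + (- p) * F i w) + ((- p) * F j w + p ^+ 2))).
    by apply: eq_Rintegral => w _; rewrite /G iA jA /=; ring.
  have H1 : P.-integrable setT (EFin \o (fun w => F i w * F j w + (- p) * F i w)).
    by have := integrableD measurableT (FFi i j) (Fi i (- p)); apply: eq_integrable.
  have H2 : P.-integrable setT (EFin \o (fun w => (- p) * F j w + p ^+ 2)).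
    by have := integrableD measurableT (Fi j (- p)) (ci (p ^+ 2)); apply: eq_integrable.
  have F1i k : P.-integrable setT (EFin \o F k).
    by apply: (@bounded_integrable _ _ _ _ _ 1).
  rewrite (RintegralD measurableT H1 H2) (RintegralD measurableT (FFi i j) (Fi i (- p))).
  rewrite (RintegralD measurableT (Fi j (- p)) (ci (p ^+ 2))).
  rewrite (RintegralZl (- p) measurableT (F1i i)) (RintegralZl (- p) measurableT (F1i j)).
  rewrite !pE// Rintegral_probability_cst; have [<-|ij] := eqVneq i j.
    have -> : \int[P]_w (F i w * F i w) = p.
      rewrite -(pE i iA); apply: eq_Rintegral => w _.
      by rewrite /F; case: (_ < _)%R; rewrite ?mulr1 ?mulr0.
    ring.
  rewrite ppE//; ring.
have [WW_int WWE] := Rintegral_sum (index_enum (I * I)%type) GG_int.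
pose M := [set w | exists2 i, i \in A & (s < Z i w)%R].
have mM : measurable (~` M).
  apply: measurableC; rewrite (_ : M = \bigcup_(i in [set` A]) [set w | s < Z i w]).
    by apply: fin_bigcup_measurable => // i _; exact: measurable_gt_set.
  by apply/seteqP; split => w [i iA siw]; exists i.
rewrite -/M -[P _]fineK ?fin_num_measure// lee_fin.
rewrite -[leRHS]mul1r ler_pdivlMr//.
(* Outside [M] the sum of the [G i] equals [- (N * p)], so the indicator times [(N * p) ^+ 2] is at
   most the square of this sum. The integral of that square is the variance on the right, as the
   cross terms vanish. *)
have H : fine (P (~` M)) * (N * p) ^+ 2 <= N * (p - p ^+ 2).
  have mI : measurable_fun setT (\1_(~` M) : T -> R) by exact: measurable_indic.
  have I_int : P.-integrable setT (EFin \o (\1_(~` M) : T -> R)).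
    apply: (@bounded_integrable _ _ _ _ _ 1) => // w; rewrite indicE.
    by case: (_ \in _); rewrite ?normr1 ?normr0.
  have -> : fine (P (~` M)) = \int[P]_w \1_(~` M) w.
    by rewrite /Rintegral integral_indic// setIT.
  rewrite -(RintegralZr _ measurableT I_int).
  have -> : N * (p - p ^+ 2) =
      \int[P]_w (\sum_(q <- index_enum (I * I)%type) G q.1 w * G q.2 w).
    rewrite WWE; transitivity (\sum_i \sum_j \int[P]_w (G i w * G j w)); last first.
      by rewrite pair_bigA.
    transitivity (\sum_(i in A) (p - p ^+ 2)).
      by rewrite sumr_const mulr_natl.
    rewrite big_mkcond/=; apply: eq_bigr => i _.
    rewrite (bigD1 i)//= big1 ?addr0 => [|j ji]; first by rewrite GGE eqxx.
    by rewrite GGE eq_sym (negbTE ji).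
  apply: le_Rintegral => //.
    apply: (@bounded_integrable _ _ _ _ _ ((N * p) ^+ 2)).
      by apply: measurable_funM.
    move=> w; rewrite indicE; case: (_ \in _); rewrite ?mul0r ?normr0 ?sqr_ge0//.
    by rewrite mul1r ger0_norm ?sqr_ge0.
  move=> w _; have -> : \sum_(q <- index_enum (I * I)%type) G q.1 w * G q.2 w =
      (\sum_i G i w) ^+ 2.
    by rewrite expr2 big_distrlr/= pair_bigA.
  rewrite indicE; have [wM|wM] := boolP (w \in _); last by rewrite mul0r sqr_ge0.
  rewrite mul1r (_ : \sum_i G i w = - (N * p)) ?sqrrN//.
  rewrite /G (eq_bigr (fun i => if i \in A then - p else 0)).
    by rewrite -big_mkcond/= sumr_const -mulr_natl mulrN.
  move=> i _; have [iA|iA] := boolP (i \in A); last by rewrite mul0r.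
  rewrite /F (_ : (s < Z i w) = false) ?mul1r ?sub0r//.
  by apply/negP => siw; move: wM; rewrite inE; apply; exists i.
rewrite -(ler_pM2r Np0) mul1r -mulrA -expr2; apply: le_trans H _.
by rewrite mulrBr gerBl mulr_ge0 ?sqr_ge0// ler0n.
Qed.

End gaussian_tail_events.

(* For [N] true nulls, [V = common_weight rho N * (mean of the X i)] is the
   multiple of their mean for which the [X i - V] are uncorrelated, and
   [common_sd rho N] is the standard deviation of [V]. *)
Definition common_weight (R : realType) (rho N : R) : R :=
  1 - Num.sqrt ((1 - rho) / (1 - rho + rho * N)).

Definition common_sd (R : realType) (rho N : R) : R :=
  common_weight rho N * Num.sqrt ((1 - rho + rho * N) / N).

(** * Bounds on the probability of a false rejection for fixed [n] *)

Section rejection_bounds.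
Context d (T : measurableType d) (R : realType) (P : probability T R).
Variables (rho : R) (X : nat -> {RV P >-> R}) (mu : nat -> R).
Hypotheses (rho_gt0 : 0 < rho) (rho_lt1 : rho < 1).
Hypothesis comb_law : forall n (a : 'I_n -> R),
  has_gaussian_law P (fun w => \sum_(i < n) a i * X i w) (\sum_(i < n) a i * mu i)
    (Num.sqrt ((1 - rho) * \sum_(i < n) a i ^+ 2 + rho * (\sum_(i < n) a i) ^+ 2)).
Variables (n : nat) (A : {set 'I_n}).
Hypotheses (A_gt0 : (0 < #|A|)%N) (muA : forall i, i \in A -> mu i = 0).

Let N : R := #|A|%:R.
(** The mean of the [X i] over [A] has variance [D / N], which is also its covariance with each of
    these [X i]. *)
Let D := 1 - rho + rho * N.
Let theta := common_weight rho N.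
Let sd := common_sd rho N.
Let k := Num.sqrt (1 - rho).

Let N_gt0 : 0 < N. Proof. by rewrite ltr0n. Qed.
Let D_gt0 : 0 < D. Proof. by rewrite addr_gt0 ?subr_gt0// mulr_gt0. Qed.
Let k_gt0 : 0 < k. Proof. by rewrite sqrtr_gt0 subr_gt0. Qed.
Let k_sqr : k ^+ 2 = 1 - rho. Proof. by rewrite sqr_sqrtr// subr_ge0 ltW. Qed.

(** This is the equation [rho - 2 theta D / N + theta^2 D / N = 0], which says that [X i - V] and
    [X j - V] are uncorrelated for distinct [i] and [j] in [A]. It also makes [1 - rho] the variance
    of [X i - V], whence the factor [k]. *)
Let theta_sqr : (1 - theta) ^+ 2 = (1 - rho) / D.
Proof.
by rewrite /theta /common_weight opprB addrC subrK sqr_sqrtr// divr_ge0 ?subr_ge0 ?ltW.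
Qed.

Let theta_gt0 : 0 < theta.
Proof.
rewrite /theta /common_weight subr_gt0 -[ltRHS]sqrtr1 ltr_sqrt// -/D.
by rewrite ltr_pdivrMr// mul1r /D ltrDl mulr_gt0.
Qed.

Let sd_gt0 : 0 < sd.
Proof. by rewrite mulr_gt0// sqrtr_gt0 divr_gt0. Qed.

Let b := theta / N.
Let V w := \sum_(i < n) (i \in A)%:R * b * X i w.
Let Z (i : 'I_n) w := (X i w - V w) / k.

Let mX i : measurable_fun setT (X i).
Proof. exact: measurable_funPT. Qed.

Let mV : measurable_fun setT V.
Proof. by apply: measurable_sum => i; exact: measurable_funM. Qed.

Let mZ i : measurable_fun setT (Z i).
Proof. by apply: measurable_funM => //; exact: measurable_funB. Qed.

Let sum_indicator (x : R) : \sum_(i < n) (i \in A)%:R * x = N * x.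
Proof.
rewrite (eq_bigr (fun i => if i \in A then x else 0)).
  by rewrite -big_mkcond/= sumr_const mulr_natl.
by move=> i _; case: (_ \in _); rewrite ?mul1r ?mul0r.
Qed.

Let sum_mu (a : 'I_n -> R) : (forall i, i \notin A -> a i = 0) ->
  \sum_(i < n) a i * mu i = 0.
Proof.
move=> aA; rewrite big1// => i _; have [/muA ->|/aA ->] := boolP (i \in A).
  by rewrite mulr0.
by rewrite mul0r.
Qed.

Let V_law : has_gaussian_law P V 0 sd.
Proof.
have H := comb_law (fun i => (i \in A)%:R * b).
rewrite sum_mu in H; last by move=> i /negbTE ->; rewrite mul0r.
rewrite sum_indicator in H.
have E : \sum_(i < n) ((i \in A)%:R * b) ^+ 2 = N * b ^+ 2.
  rewrite -sum_indicator; apply: eq_bigr => i _.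
  by case: (_ \in _); rewrite ?mul1r// !mul0r expr0n.
rewrite E in H.
suff sdE : sd = Num.sqrt ((1 - rho) * (N * b ^+ 2) + rho * (N * b) ^+ 2) by rewrite sdE.
rewrite /sd /common_sd -/theta -/D.
rewrite -[theta in LHS](ger0_norm (ltW theta_gt0)) -sqrtr_sqr -sqrtrM ?sqr_ge0//.
by congr Num.sqrt; rewrite /b /D; field; rewrite gt_eqF.
Qed.

(** Rewritten in terms of the [X i], the combination has coefficients [a], and [theta_sqr] reduces
    the variance given by [comb_law] to the sum of the squares of [c]. *)
Let Z_law (c : 'I_n -> R) : (forall i, i \notin A -> c i = 0) ->
  has_gaussian_law P (fun w => \sum_(i < n) c i * Z i w) 0
    (Num.sqrt (\sum_(i < n) c i ^+ 2)).
Proof.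
move=> cA; pose C := \sum_(i < n) c i.
pose a i := (c i - (i \in A)%:R * (C * b)) / k.
have H := comb_law a.
have aA i : i \notin A -> a i = 0.
  by move=> iA; rewrite /a cA// (negbTE iA) mul0r subr0 mul0r.
rewrite (sum_mu aA) in H.
have aE : \sum_(i < n) a i = C * (1 - theta) / k.
  rewrite -mulr_suml sumrB sum_indicator -/C /b; congr (_ / _).
  by field; rewrite gt_eqF.
have a2E : \sum_(i < n) a i ^+ 2 =
    (\sum_(i < n) c i ^+ 2 - 2 * C * b * C + N * (C * b) ^+ 2) / k ^+ 2.
  rewrite (eq_bigr (fun i => (c i ^+ 2 - 2 * C * b * c i +
      (i \in A)%:R * (C * b) ^+ 2) / k ^+ 2)); last first.
    move=> i _; rewrite /a expr_div_n; congr (_ / _).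
    have [iA|iA] := boolP (i \in A); first by rewrite !mul1r; ring.
    by rewrite cA// !mul0r; ring.
  by rewrite -mulr_suml big_split/= sumrB -mulr_sumr sum_indicator.
have CE : \sum_(i < n) c i = C by [].
(* From here on [C] is an atom for [ring] and [field]; [CE] retains its value. *)
clearbody C.
have YE : (fun w => \sum_(i < n) a i * X i w) = (fun w => \sum_(i < n) c i * Z i w).
  apply/funext => w; rewrite /Z /a.
  transitivity ((\sum_(i < n) c i * X i w - C * V w) / k).
    rewrite /V mulr_sumr -sumrB mulr_suml.
    by apply: eq_bigr => i _; ring.
  rewrite [RHS](eq_bigr (fun i => c i * X i w / k - c i * (V w / k))); last first.
    by move=> i _; ring.
  by rewrite sumrB -!mulr_suml CE mulrBl mulrA.
rewrite YE in H.
suff E : \sum_(i < n) c i ^+ 2 =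
    (1 - rho) * \sum_(i < n) a i ^+ 2 + rho * (\sum_(i < n) a i) ^+ 2 by rewrite E.
rewrite a2E aE k_sqr expr_div_n k_sqr [(C * (1 - theta)) ^+ 2]exprMn theta_sqr.
(* With [theta_sqr] solved for the square, the remaining identity is linear in [theta]. *)
have T2 : theta ^+ 2 = 2 * theta - rho * N / D.
  have := theta_sqr; rewrite sqrrB expr1n mul1r => E.
  have -> : rho * N / D = 1 - (1 - rho) / D.
    by rewrite /D; field; rewrite -/D gt_eqF.
  by rewrite -E; ring.
have r1 : 1 - rho != 0 by rewrite gt_eqF// subr_gt0.
have Nn : N != 0 by rewrite gt_eqF.
have Dn : D != 0 by rewrite gt_eqF.
rewrite exprMn /b expr_div_n T2.
by field; rewrite r1 Nn Dn.
Qed.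

Let pair_coef (i j : 'I_n) (x y : R) (l : 'I_n) : R :=
  x * (l == i)%:R + y * (l == j)%:R.

Let sum_delta (i : 'I_n) (f : 'I_n -> R) : \sum_(l < n) (l == i)%:R * f l = f i.
Proof.
rewrite (bigD1 i)//= eqxx mul1r big1 ?addr0// => l /negbTE ->.
by rewrite mul0r.
Qed.

Let Z_pair_law (i j : 'I_n) (x y : R) : i \in A -> j \in A -> i != j ->
  has_gaussian_law P (fun w => x * Z i w + y * Z j w) 0
    (Num.sqrt (x ^+ 2 + y ^+ 2)).
Proof.
move=> iA jA ij; have cA l : l \notin A -> pair_coef i j x y l = 0.
  move=> lA; rewrite /pair_coef; have [li|_] := eqVneq l i.
    by rewrite li iA in lA.
  have [lj|_] := eqVneq l j; first by rewrite lj jA in lA.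
  by rewrite !mulr0 addr0.
have := Z_law cA.
have -> : (fun w => \sum_(l < n) pair_coef i j x y l * Z l w) =
    (fun w => x * Z i w + y * Z j w).
  apply/funext => w; rewrite -(sum_delta i (fun l => x * Z l w)).
  rewrite -(sum_delta j (fun l => y * Z l w)) -big_split/=.
  by apply: eq_bigr => l _; rewrite /pair_coef; ring.
suff -> : \sum_(l < n) pair_coef i j x y l ^+ 2 = x ^+ 2 + y ^+ 2 by [].
rewrite -(sum_delta i (fun=> x ^+ 2)) -(sum_delta j (fun=> y ^+ 2)) -big_split/=.
apply: eq_bigr => l _; rewrite /pair_coef.
have [->|li] := eqVneq l i; first by rewrite (negbTE ij) /=; ring.
by case: (l == j) => /=; ring.
Qed.

Let Z_law1 (i : 'I_n) : i \in A -> has_gaussian_law P (Z i) 0 1.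
Proof.
move=> iA; have cA l : l \notin A -> (l == i)%:R = 0 :> R.
  by have [->|//] := eqVneq l i; rewrite iA.
have := Z_law cA.
have -> : (fun w => \sum_(l < n) (l == i)%:R * Z l w) = Z i.
  by apply/funext => w; rewrite sum_delta.
have -> : \sum_(l < n) (l == i)%:R ^+ 2 = 1 :> R.
  rewrite -[RHS](sum_delta i (fun=> 1)); apply: eq_bigr => l _.
  by case: (l == i); rewrite ?mul1r ?expr1n// mul0r expr0n.
by rewrite sqrtr1.
Qed.

Let Z_tail (i : 'I_n) s : i \in A -> P [set w | s < Z i w] = (tail s)%:E.
Proof. by move=> iA; rewrite (gaussian_tail s ltr01 (Z_law1 iA)) divr1. Qed.

Let max_Z_gt s := [set w | exists2 i, i \in A & s < Z i w].

Let max_Z_gtE s : max_Z_gt s = \bigcup_(i in [set` A]) [set w | s < Z i w].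
Proof. by apply/seteqP; split => w [i iA siw]; exists i. Qed.

Let measurable_max_Z_gt s : measurable (max_Z_gt s).
Proof.
rewrite max_Z_gtE; apply: fin_bigcup_measurable => // i _.
exact: measurable_gt_set.
Qed.

Let max_Z_gt_le s : (P (max_Z_gt s) <= (N * tail s)%:E)%E.
Proof. by apply: exceedance_le => // i iA; exact: Z_tail. Qed.

Let max_Z_le_le s : (P (~` max_Z_gt s) <= ((N * tail s)^-1)%:E)%E.
Proof.
apply: no_exceedance_le => //.
- by move=> i iA; rewrite Rintegral_gt// Z_tail.
- move=> i j iA jA ij.
  rewrite (gaussian_pair_tail (mZ i) (mZ j) (fun x y => Z_pair_law x y iA jA ij)).
  by rewrite !Rintegral_gt// !Z_tail.
- by rewrite mulr_gt0// tail_gt0.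
Qed.

Let some_rejection x := [set w | exists2 i : 'I_n, i \in A & x < X i w].

Let measurable_some_rejection x : measurable (some_rejection x).
Proof.
rewrite (_ : some_rejection x = \bigcup_(i in [set` A]) [set w | x < X i w]).
  by apply: fin_bigcup_measurable => // i _; exact: measurable_gt_set.
by apply/seteqP; split => w [i iA siw]; exists i.
Qed.

Let X_decomposition (i : 'I_n) w : X i w = V w + k * Z i w.
Proof. by rewrite /Z mulrC divfK ?gt_eqF// addrC subrK. Qed.

Let V_tail x : P [set w | x < V w] = (tail (x / sd))%:E.
Proof. exact: gaussian_tail sd_gt0 V_law. Qed.

(** If no [Z i] exceeds [s], a rejection [X i > x] forces [V > x - k * s]; the exceptional event is
    controlled by the union bound. *)
Lemma some_rejection_le x s :
  (P [set w | exists2 i : 'I_n, i \in A & (x < X i w)%R] <=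
   (tail ((x - k * s) / sd) + N * tail s)%:E)%E.
Proof.
rewrite EFinD -V_tail.
apply: (@le_trans _ _ (P ([set w | x - k * s < V w] `|` max_Z_gt s))); last first.
  have U2 := @measureU2 _ _ _ P _ _ (measurable_gt_set (x - k * s) mV)
    (measurable_max_Z_gt s).
  apply: (le_trans U2).
  by apply: leeD2l; exact: max_Z_gt_le.
apply: le_measure; rewrite ?inE//; first exact: measurable_some_rejection.
  by apply: measurableU => //; exact: measurable_gt_set.
move=> w [i iA xX]; have [sZ|Zs] := ltP s (Z i w); first by right; exists i.
left => /=; rewrite X_decomposition in xX.
have : k * Z i w <= k * s by rewrite ler_pM2l.
lra.
Qed.

(** If [V > x - k * s] and some [Z i] exceeds [s], then [X i > x]; Chebyshev's inequality controls
    the absence of such a [Z i]. *)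
Lemma some_rejection_ge x s :
  ((tail ((x - k * s) / sd) - (N * tail s)^-1)%:E <=
   P [set w | exists2 i : 'I_n, i \in A & (x < X i w)%R])%E.
Proof.
rewrite EFinB leeBlDr// -V_tail.
apply: (@le_trans _ _ (P (some_rejection x `|` ~` max_Z_gt s))); last first.
  have U2 := @measureU2 _ _ _ P _ _ (measurable_some_rejection x)
    (measurableC (measurable_max_Z_gt s)).
  apply: (le_trans U2).
  by apply: leeD2l; exact: max_Z_le_le.
apply: le_measure; rewrite ?inE//; first exact: measurable_gt_set.
  by apply: measurableU => //; exact: measurableC.
move=> w /= xV; have [[i iA sZ]|nM] := pselect (max_Z_gt s w); last by right.
left; exists i => //; rewrite X_decomposition.
have : k * s < k * Z i w by rewrite ltr_pM2l.
lra.
Qed.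

End rejection_bounds.

(** * Asymptotics of the quantile and of the error terms *)

Section limits.
Context {R : realType}.

Lemma cvg_invn : (n%:R^-1 : R) @[n --> \oo] --> (0 : R).
Proof. by rewrite -(cvg_shiftS (fun n => n%:R^-1 : R)); exact: cvg_harmonic. Qed.

Definition top_quantile (n : nat) : R := Phi_inv (1 - n%:R^-1).

Lemma tail_top_quantile n : (1 < n)%N -> tail (top_quantile n) = n%:R^-1.
Proof.
move=> n1; apply: tail_Phi_inv.
by rewrite invr_gt0 ltr0n (ltnW n1)/= invf_lt1 ?ltr1n// ltr0n (ltnW n1).
Qed.

(** The tail at the quantile is [n%:R^-1], eventually below the positive number [tail x], and the
    tail is nonincreasing. *)
Lemma near_top_quantile_gt (x : R) : \forall n \near \oo, x < top_quantile n.
Proof.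
have H := cvgr_lt _ cvg_invn _ (tail_gt0 x).
near=> n; have lt_n : n%:R^-1 < tail x by near: n; exact: H.
rewrite ltNge; apply/negP => /tail_nonincreasing.
rewrite tail_top_quantile; last by near: n; exact: nbhs_infty_gt.
by rewrite leNgt lt_n.
Unshelve. all: by end_near. Qed.

(* The maximum of [n] independent standard normals lies within [window n] of
   [top_quantile n] with probability tending to 1. *)
Definition window (n : nat) : R := (Num.sqrt (top_quantile n))^-1.

Lemma cvg_window : window n @[n --> \oo] --> (0 : R).
Proof.
apply/cvgrPdist_lt => e e0; near=> n.
have q0 : e ^- 2 < top_quantile n by near: n; exact: near_top_quantile_gt.
have s0 : e^-1 < Num.sqrt (top_quantile n).
  rewrite -[ltLHS]ger0_norm ?invr_ge0 ?ltW// -sqrtr_sqr ltr_sqrt ?exprVn//.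
  by rewrite (lt_trans _ q0)// invr_gt0 exprn_gt0.
rewrite sub0r normrN /window ger0_norm ?invr_ge0 ?sqrtr_ge0//.
by rewrite -[ltRHS]invrK ltf_pV2 ?posrE ?invr_gt0// (lt_trans _ s0)// invr_gt0.
Unshelve. all: by end_near. Qed.

(** Dividing by [N n] inside the roots expresses everything through [h n = (1 - rho) / N n], which
    tends to 0. *)
Lemma cvg_common_sd (rho : R) (N : nat -> R) : 0 < rho -> rho < 1 ->
  (forall n, 0 <= N n) -> (\forall n \near \oo, 0 < N n) ->
  (N n)^-1 @[n --> \oo] --> (0 : R) ->
  common_sd rho (N n) @[n --> \oo] --> Num.sqrt rho.
Proof.
move=> rho0 rho1 N0 N_gt0 Nlim; pose h n := (1 - rho) * (N n)^-1.
have hlim : h n @[n --> \oo] --> (0 : R).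
  by rewrite -(mulr0 (1 - rho)); apply: cvgM => //; exact: cvg_cst.
have hrlim : h n + rho @[n --> \oo] --> rho.
  by rewrite -[X in _ --> X]add0r; apply: cvgD => //; exact: cvg_cst.
have A : h n / (h n + rho) @[n --> \oo] --> (0 : R).
  rewrite -[X in _ --> X](mul0r rho^-1); apply: cvgM => //.
  by apply: cvgV => //; rewrite gt_eqF.
have B : Num.sqrt (h n / (h n + rho)) @[n --> \oo] --> (0 : R).
  rewrite -[X in _ --> X](sqrtr0 R).
  exact: (continuous_cvg _ (@sqrt_continuous R 0) A).
have C : Num.sqrt (h n + rho) @[n --> \oo] --> Num.sqrt rho.
  exact: (continuous_cvg _ (@sqrt_continuous R rho) hrlim).
have L : (1 - Num.sqrt (h n / (h n + rho))) * Num.sqrt (h n + rho) @[n --> \oo] -->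
    Num.sqrt rho.
  rewrite -[X in _ --> X]mul1r; apply: cvgM => //.
  rewrite -[X in _ --> X]subr0; apply: cvgB => //; exact: cvg_cst.
apply: cvg_trans L; apply: near_eq_cvg; near=> n.
have Nn : 0 < N n by near: n.
rewrite /common_sd /common_weight /h; congr ((1 - Num.sqrt _) * Num.sqrt _).
  have Dn : 1 - rho + rho * N n != 0.
    by rewrite gt_eqF// addr_gt0 ?subr_gt0 ?mulr_gt0.
  field.
  rewrite Dn gt_eqF//=.
by field; rewrite gt_eqF.
Unshelve. all: by end_near. Qed.

Lemma expRN_le_inv (t : R) : 0 < t -> expR (- t) <= t^-1.
Proof.
move=> t0; rewrite expRN lef_pV2 ?posrE ?expR_gt0//.
by apply: le_trans (expR_ge1Dx t); rewrite lerDr.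
Qed.

Let window_props n : 1 < top_quantile n ->
  [/\ 0 < window n, window n <= 1 & top_quantile n * window n = (window n)^-1].
Proof.
move=> q1; have q0 : 0 < top_quantile n by exact: lt_trans q1.
have s1 : 1 <= Num.sqrt (top_quantile n) by rewrite -[leLHS]sqrtr1 ler_sqrt ltW.
have s0 : 0 < Num.sqrt (top_quantile n) by exact: lt_le_trans s1.
split; rewrite /window.
- by rewrite invr_gt0.
- by rewrite invf_le1.
- by rewrite invrK -{1}(sqr_sqrtr (ltW q0)) expr2 mulfK ?gt_eqF.
Qed.

(** With [q] the quantile and [e] the window, [q e = 1 / e], so [tail_shift] leaves
    [exp (- 1 / e) <= e]. *)
Lemma tail_above_quantile_le n : (1 < n)%N -> 1 < top_quantile n ->
  n%:R * tail (top_quantile n + window n) <= window n.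
Proof.
move=> n1 q1; have [e0 _ qe] := window_props q1.
have n0 : 0 < n%:R :> R by rewrite ltr0n ltnW.
rewrite -ler_pdivlMl//; apply: le_trans (tail_shift _ (ltW e0)) _.
rewrite tail_top_quantile// mulrC ler_wpM2l ?invr_ge0 ?(ltW n0)// qe.
by have := @expRN_le_inv (window n)^-1; rewrite invrK invr_gt0; apply.
Qed.

(** Shifting from [q - e] up to [q] costs the factor [exp (e^2) exp (- 1 / e)], at most [exp 1]
    times [e] since [e <= 1]. *)
Lemma tail_below_quantile_ge n : (1 < n)%N -> 1 < top_quantile n ->
  (n%:R * tail (top_quantile n - window n))^-1 <= expR 1 * window n.
Proof.
move=> n1 q1; have [e0 e1 qe] := window_props q1.
have n0 : 0 < n%:R :> R by rewrite ltr0n ltnW.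
have := tail_shift (top_quantile n - window n) (ltW e0).
rewrite subrK tail_top_quantile//; set t := tail _ => H.
have t0 : 0 < t by exact: tail_gt0.
rewrite invfM -ler_pdivlMr ?invr_gt0// invrK; apply: le_trans H _.
rewrite ler_wpM2r ?(ltW t0)// mulrBl qe opprB expRD ler_pM ?expR_ge0//.
  by rewrite ler_expR -expr2 exprn_ile1// ltW.
by have := @expRN_le_inv (window n)^-1; rewrite invrK invr_gt0; apply.
Qed.

End limits.

(** * The limit of the family-wise error rate *)

Theorem theorem3p2 (R : realType) (d : measure_display) (T : measurableType d)
    (P : probability T R) (rho alpha : R)
    (X : nat -> {RV P >-> R}) (mu : nat -> R) (p0 : R)
    (rho_gt0 : 0 < rho) (rho_lt1 : rho < 1)
    (alpha_gt0 : 0 < alpha) (alpha_lt1 : alpha < 1)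
    (X_gauss : jointly_gaussian P X)
    (X_law : forall i : nat, has_gaussian_law P (X i) (mu i) 1)
    (mu_ge0 : forall i : nat, 0 <= mu i)
    (X_corr : forall i j : nat, i != j -> correlation P (X i) (X j) = rho)
    (p0_gt0 : 0 < p0)
    (cvg_p0 : (#|true_nulls mu n|%:R / n%:R : R) @[n --> \oo] --> p0) :
  (FWER P (true_nulls mu n) (rejections X n (critical_value n alpha rho)))
    @[n --> \oo] --> alpha%:E
  /\
  (P (\bigcup_(i in [set` true_nulls mu n])
        [set w | critical_value n alpha rho < X i w]))
    @[n --> \oo] --> alpha%:E.
Proof.
pose N n : R := #|true_nulls mu n|%:R.
pose c n := critical_value n alpha rho.
pose E n := [set w | exists2 i : 'I_n, i \in true_nulls mu n & (c n < X i w)%R].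
(* Both probabilities in the conclusion are that of [E n]. *)
suff L : P (E n) @[n --> \oo] --> alpha%:E.
  split.
    rewrite (_ : (fun n => FWER _ _ _) = fun n => P (E n))//.
    apply/funext => n; congr (P _); apply/seteqP; split => w /=.
      by move=> /card_gt0P[i]; rewrite !inE => /andP[i0 ci]; exists i; rewrite ?inE.
    by case=> i i0 ci; apply/card_gt0P; exists i; rewrite !inE in i0 *; rewrite i0.
  have EE n : \bigcup_(i in [set` true_nulls mu n]) [set w | c n < X i w] = E n.
    by apply/seteqP; split => w [i i0 ci]; exists i.
  by under eq_fun do rewrite EE.
have comb n (a : 'I_n -> R) :=
  linear_combination_law rho_gt0 X_gauss X_law X_corr a.
have N_gt0 : \forall n \near \oo, 0 < N n.
  have H := cvgr_gt _ cvg_p0 _ p0_gt0.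
  near=> n; have : 0 < N n / n%:R by near: n; exact: H.
  rewrite lt0r mulf_eq0 negb_or => /andP[/andP[Nn _] _].
  by rewrite lt_neqAle eq_sym Nn ler0n.
(* The number of true nulls is [n] times a proportion with positive limit [p0]. *)
have Ninv : (N n)^-1 @[n --> \oo] --> (0 : R).
  have H : n%:R^-1 * (N n / n%:R)^-1 @[n --> \oo] --> (0 : R).
    rewrite -[X in _ --> X](mul0r p0^-1); apply: cvgM; first exact: cvg_invn.
    by apply: cvgV => //; rewrite gt_eqF.
  apply: cvg_trans H; apply: near_eq_cvg; near=> n.
  have n0 : n%:R != 0 :> R by rewrite pnatr_eq0 -lt0n; near: n; exact: nbhs_infty_gt.
  have Nn : 0 < N n by near: n.
  by field; rewrite n0 gt_eqF.
have sd_cvg : common_sd rho (N n) @[n --> \oo] --> Num.sqrt rho.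
  exact: cvg_common_sd.
pose k := Num.sqrt (1 - rho); pose a := Phi_inv alpha.
have sqrt_rho0 : Num.sqrt rho != 0 by rewrite gt_eqF// sqrtr_gt0.
(* The level [c n - k * s] with [s] one window above or below the quantile has this form with
   [b = - k] or [b = k], as the quantile cancels. The limit is [tail (- a) = Phi a = alpha]. *)
have tail_cvg (b : R) : tail ((- (Num.sqrt rho * a) + b * window n)
    / common_sd rho (N n)) @[n --> \oo] --> alpha.
  have aE : tail (- a) = alpha by rewrite tail_NPhi_inv// alpha_gt0.
  have arg : (- (Num.sqrt rho * a) + b * window n) / common_sd rho (N n) @[n --> \oo]
      --> - a.
    rewrite (_ : - a = (- (Num.sqrt rho * a) + b * 0) / Num.sqrt rho); last by field.
    apply: cvgM; last exact: cvgV.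
    apply: cvgD; first exact: cvg_cst.
    by apply: cvgM; [exact: cvg_cst|exact: cvg_window].
  rewrite -[X in _ --> X]aE.
  exact: (continuous_cvg _ (@continuous_tail R (- a)) arg).
(* The Chebyshev error refers to [N n] instead of [n], hence the division by [N n / n%:R]; for the
   union bound in [upper], [N n <= n%:R] suffices. *)
pose lower n := tail ((- (Num.sqrt rho * a) + k * window n) / common_sd rho (N n))
  - expR 1 * window n / (N n / n%:R).
pose upper n := tail ((- (Num.sqrt rho * a) + (- k) * window n) / common_sd rho (N n))
  + window n.
apply: (squeeze_cvge (f := EFin \o lower) (h := EFin \o upper)).
- near=> n.
  have n1 : (1 < n)%N by near: n; exact: nbhs_infty_gt.
  have q1 : 1 < top_quantile n :> R by near: n; exact: near_top_quantile_gt.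
  have Nn : 0 < N n by near: n.
  have A0 : (0 < #|true_nulls mu n|)%N by rewrite -(ltr0n R).
  have muA (i : 'I_n) : i \in true_nulls mu n -> mu i = 0 by rewrite inE => /eqP.
  have n0 : 0 < n%:R :> R by rewrite ltr0n ltnW.
  have Nle : N n <= n%:R by rewrite ler_nat -[leqRHS]card_ord max_card.
  have c_minus : c n - Num.sqrt (1 - rho) * (top_quantile n - window n) =
      - (Num.sqrt rho * a) + k * window n.
    by rewrite /c /critical_value -/a -/k -/(top_quantile n); ring.
  have c_plus : c n - Num.sqrt (1 - rho) * (top_quantile n + window n) =
      - (Num.sqrt rho * a) + (- k) * window n.
    by rewrite /c /critical_value -/a -/k -/(top_quantile n); ring.
  apply/andP; split.
    have := some_rejection_ge rho_gt0 rho_lt1 comb A0 muA (c n)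
      (top_quantile n - window n).
    rewrite c_minus; apply: le_trans; rewrite lee_fin /lower; apply: lerB => //.
    have tb := tail_below_quantile_ge n1 q1.
    have t0 := tail_gt0 (top_quantile n - window n : R).
    rewrite (_ : (_ * tail _)^-1 = (n%:R * tail (top_quantile n - window n))^-1
      / (N n / n%:R)); last by rewrite /N; field; rewrite !gt_eqF.
    rewrite ler_wpM2r// invr_ge0; exact: divr_ge0 (ltW Nn) (ltW n0).
  have := some_rejection_le rho_gt0 rho_lt1 comb A0 muA (c n)
    (top_quantile n + window n).
  rewrite c_plus => H; apply: (le_trans H); rewrite lee_fin /upper; apply: lerD => //.
  apply: le_trans (tail_above_quantile_le n1 q1).
  by rewrite ler_wpM2r// tail_ge0.
- apply: cvg_EFin; first exact: nearW.
  rewrite -[X in _ --> X]subr0; apply: cvgB; first exact: tail_cvg.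
  rewrite -[X in _ --> X](mul0r p0^-1) -[X in X * _](mulr0 (expR 1)).
  apply: cvgM; last by apply: cvgV => //; rewrite gt_eqF.
  by apply: cvgM; [exact: cvg_cst|exact: cvg_window].
- apply: cvg_EFin; first exact: nearW.
  rewrite -[X in _ --> X]addr0; apply: cvgD; first exact: tail_cvg.
  exact: cvg_window.
Unshelve. all: by end_near. Qed.
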